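(* Let $d\in\mathbb N^+$, $\lambda,\mu>0$, $\alpha=\lambda$ and $\mu\ne\lambda$. For $0<t<\log(\mu/\lambda)/(\mu-\lambda)$, the integral equation satisfied by the emptiness probability $p(0,t)$ of the process $\mathcal N$ (defined in the context), namely $$p(0,t)=1-G(t)-(d-1)\int_0^tG'(t-y)\,p(0,y)\,dy,\qquad G(t)=1-\frac{\mu-\lambda}{\mu-\lambda e^{-(\mu-\lambda)t}},$$ admits the following solution: $$\begin{aligned}p(0,t)=1-d\Bigg\{&1-\frac{\mu-\lambda}{\mu-\lambda e^{-(\mu-\lambda)t}}-\frac{1}{d-1}\left[e^{-\lambda t(d-1)}-1+\lambda t(d-1)\right]\\&-\sum_{n=3}^{\infty}\frac{(-\lambda t)^n}{n!}\sum_{k=1}^{n-2}(d-1)^k\sum_{j=1}^{n-k-1}\binom{k+1}{j}Q_{j,j+n-k-1}\Bigg\},\end{aligned}$$ where $$Q_{j,m}=\sum_{\substack{s_1,\ldots,s_j\ge2\\ s_1+\cdots+s_j=m}}A_{s_1}\!\left(\frac{\mu}{\lambda}\right)\cdots A_{s_j}\!\left(\frac{\mu}{\lambda}\right)$$ and $A_n$ denotes the $n$-th Eulerian polynomial. For $d=1$ the term $\frac{1}{d-1}[e^{-\lambda t(d-1)}-1+\lambda t(d-1)]$ is read as its limiting value $0$.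
   Context: Let $D=\{1,\ldots,d\}$. $\mathcal N=\{(N(t),J(t)),t\ge 0\}$ is the (nonexplosive) continuous-time Markov chain on $S=\{(0,0)\}\cup(\mathbb N^+\times D)$ whose only nonzero off-diagonal transition rates are, for $k\in\mathbb N^+$ and $j\in D$: from $(0,0)$ to $(1,j)$ at rate $\alpha$; from $(k,j)$ to $(k+1,j)$ at rate $\alpha+\lambda k$; from $(k,j)$ to $(k-1,j)$ at rate $\mu k$, where $(0,j)$ is identified with $(0,0)$ for every $j$. The initial state is $0:=(0,0)$, and $p(0,t)=\mathbb P\{(N(t),J(t))=0\mid (N(0),J(0))=0\}$. The Eulerian polynomials $A_n(x)$ are normalized by $\sum_{n\ge0}A_n(x)\frac{u^n}{n!}=\frac{x-1}{x-e^{u(x-1)}}$, so that $A_0(x)=A_1(x)=1$, $A_2(x)=1+x$, $A_3(x)=1+4x+x^2$. *)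

(* Defs.v *)
From mathcomp Require Import all_boot all_order all_algebra.
From mathcomp Require Import all_classical all_reals all_analysis.
From mathcomp Require Import ring.

Set Implicit Arguments.
Unset Strict Implicit.
Unset Printing Implicit Defensive.

Import Order.TTheory GRing.Theory Num.Theory.
Import numFieldNormedType.Exports.

Local Open Scope classical_set_scope.
Local Open Scope ring_scope.

Section MarkovChain.
Context {R : realType} {S : countType}.

(* [Pt t x y] is the probability of going from [x] to [y] in time [t]; only
   [0 <= t] matters.  The row sums are exactly 1: the chain is nonexplosive. *)
Definition transition_function (Pt : R -> S -> S -> R) : Prop :=
  [/\ forall t x y, 0 <= t -> 0 <= Pt t x y,
      forall t x, 0 <= t -> \esum_(y in [set: S]) (Pt t x y)%:E = 1%E,
      forall x y, Pt 0 x y = (x == y)%:R &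
      forall s t x y, 0 <= s -> 0 <= t ->
        \esum_(z in [set: S]) (Pt s x z * Pt t z y)%:E = (Pt (s + t) x y)%:E].

(* [q x y] is the rate from [x] to [y] for [x != y]; the diagonal of [q] is not
   used, since the total rate out of [x] is the sum of the rates to [y != x]. *)
Definition has_rates (Pt : R -> S -> S -> R) (q : S -> S -> R) : Prop :=
  (forall x y, x != y -> Pt h x y / h @[h --> 0^'+] --> q x y) /\
  (forall x, ((1 - Pt h x x) / h)%:E @[h --> 0^'+]
               --> \esum_(y in [set~ x]) (q x y)%:E).

Context {disp : measure_display} {T : measurableType disp}.

Definition history (X : R -> T -> S) (w : seq (R * S)) : set T :=
  [set omega | forall a, a \in w -> X a.1 omega = a.2].

(* The Markov property is written multiplicatively, as
   P(past, X_s = x, X_(s+t) = y) = P(past, X_s = x) Pt(t, x, y),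
   so that nothing is divided by the probability of a null event. *)
Definition markov_chain (P : probability T R) (X : R -> T -> S)
    (x0 : S) (q : S -> S -> R) : Prop :=
  [/\ forall t x, 0 <= t -> measurable (X t @^-1` [set x]),
      P (X 0 @^-1` [set x0]) = 1%E &
      exists Pt : R -> S -> S -> R,
        [/\ transition_function Pt, has_rates Pt q &
            forall (w : seq (R * S)) (s t : R) (x y : S),
              0 <= s -> 0 <= t -> all (fun a => 0 <= a.1 <= s) w ->
              P (history X w `&` X s @^-1` [set x] `&` X (s + t) @^-1` [set y])
              = (P (history X w `&` X s @^-1` [set x]) * (Pt t x y)%:E)%E]].

(* P(X_t = x | X_0 = x) *)
Definition return_probability (P : probability T R) (X : R -> T -> S)
    (x : S) (t : R) : R :=
  fine (P (X t @^-1` [set x] `&` X 0 @^-1` [set x]))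
  / fine (P (X 0 @^-1` [set x])).

End MarkovChain.

(* [None] is the state (0,0) and [Some (k, j)] is the state (k + 1, j): the
   first component is shifted by one so that it is positive.  The arm labels
   1, ..., d are represented by the elements of ['I_d]. *)
Definition state (d : nat) : Type := option (nat * 'I_d).

Definition origin {d : nat} : state d := None.

(* the state (k, j), with (0, j) identified with (0, 0) *)
Definition site {d : nat} (k : nat) (j : 'I_d) : state d :=
  if k is m.+1 then Some (m, j) else origin.

Definition star_rate {R : realType} {d : nat} (alpha lambda mu : R)
    (x y : state d) : R :=
  match x with
  | None => if [exists j : 'I_d, y == site 1 j] then alpha else 0
  | Some (m, j) =>
      let k := m.+1 in
      if y == site k.+1 j then alpha + lambda * k%:R
      else if y == site k.-1 j then mu * k%:R
      else 0
  end.

Section Eulerian.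
Context {R : realType}.

(* Formal power series in u over R[x] are given by their coefficients. *)
Definition series_mul (a b : nat -> {poly R}) (n : nat) : {poly R} :=
  \sum_(i < n.+1) a i * b (n - i)%N.

(* e^(u c) *)
Definition series_exp (c : {poly R}) (n : nat) : {poly R} :=
  (n`!%:R^-1 : R) *: c ^+ n.

(* sum_n A_n(x) u^n / n! = (x - 1) / (x - e^(u (x - 1))), that is,
   (x - e^(u (x - 1))) * sum_n A_n(x) u^n / n! = x - 1 in R[x][[u]]. *)
Definition eulerian_polynomials (A : nat -> {poly R}) : Prop :=
  forall n,
    series_mul (fun i => 'X *+ (i == 0%N) - series_exp ('X - 1) i)
               (fun i => (i`!%:R^-1 : R) *: A i) n
    = ('X - 1) *+ (n == 0%N).

Lemma eulerian_polynomials_rec (A : nat -> {poly R}) :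
  eulerian_polynomials A <->
  A 0%N = 1 /\
  forall n, A n.+1 = \sum_(i < n.+1)
    'C(n.+1, i.+1)%:R *: (('X - 1) ^+ i * A (n - i)%N).
Proof.
have X1 : ('X - 1 : {poly R}) != 0 by rewrite -polyC1 polyXsubC_eq0.
have fn0 m : (m`!%:R : R) != 0 by rewrite pnatr_eq0 -lt0n fact_gt0.
have key n : series_mul (fun i => 'X *+ (i == 0%N) - series_exp ('X - 1) i)
    (fun i => (i`!%:R^-1 : R) *: A i) n.+1 =
  ('X - 1) * (n.+1`!%:R^-1 *: (A n.+1 - \sum_(i < n.+1)
    'C(n.+1, i.+1)%:R *: (('X - 1) ^+ i * A (n - i)%N))).
  rewrite /series_mul big_ord_recl /= subn0 /series_exp fact0 invr1 scale1r.
  rewrite expr0 mulr1n scalerBr mulrBr; congr (_ + _).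
  rewrite scaler_sumr mulr_sumr -sumrN; apply: eq_bigr => i _.
  rewrite /bump /= add1n mulr0n sub0r subSS mulNr; congr (- _).
  rewrite scalerA -!scalerAl -!scalerAr scalerA mulrA -exprS; congr (_ *: _).
  have le : (i.+1 <= n.+1)%N by exact: ltn_ord.
  have b0 : ('C(n.+1, i.+1)%:R : R) != 0 by rewrite pnatr_eq0 -lt0n bin_gt0.
  rewrite -(bin_fact le) natrM (natrM _ i.+1`!) subSS !invfM mulrAC.
  by rewrite mulVf // mul1r.
have key0 : series_mul (fun i => 'X *+ (i == 0%N) - series_exp ('X - 1) i)
    (fun i => (i`!%:R^-1 : R) *: A i) 0 = ('X - 1) * A 0%N.
  by rewrite /series_mul big_ord1 /series_exp /= !fact0 invr1 !scale1r expr0.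
split=> [H|[A0 AS] [|n]].
- split=> [|n]; first by have := H 0%N; rewrite key0 -[RHS]mulr1 => /(mulfI X1).
  apply/eqP; rewrite -subr_eq0; have /eqP := H n.+1.
  by rewrite key mulr0n mulf_eq0 (negPf X1) /= scaler_eq0 invr_eq0 (negPf (fn0 _)).
- by rewrite key0 A0 mulr1.
- by rewrite key AS subrr scaler0 mulr0.
Qed.

Lemma eulerian_polynomials_small (A : nat -> {poly R}) :
  eulerian_polynomials A ->
  [/\ A 0%N = 1, A 1%N = 1, A 2 = 1 + 'X & A 3 = 1 + 4%:R *: 'X + 'X^2].
Proof.
move=> /eulerian_polynomials_rec[A0 AS].
have A1 : A 1%N = 1 by rewrite AS big_ord1 A0 binn expr0 mulr1 scale1r.
have A2 : A 2 = 1 + 'X.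
  rewrite AS !big_ord_recl big_ord0 /bump /= A0 A1 bin1 binn scale1r.
  by rewrite expr0 expr1 !mulr1 addr0 scaler_nat; ring.
split => //.
rewrite AS !big_ord_recl big_ord0 /bump /= A0 A1 A2 bin1 binn.
rewrite (_ : 'C(3, 2) = 3%N) // expr0 expr1 !scaler_nat !mulr1 mul1r addr0 mulr1n.
by rewrite sqrrB1 !mulrSr mulr0n; ring.
Qed.

Lemma eulerian_polynomials_exist :
  exists A : nat -> {poly R}, eulerian_polynomials A.
Proof.
pose next n (s : seq {poly R}) : {poly R} := \sum_(i < n.+1)
  'C(n.+1, i.+1)%:R *: (('X - 1) ^+ i * s`_i).
(* the list A_n, ..., A_0 *)
pose L := fix L n := if n is m.+1 then next m (L m) :: L m else [:: 1].
exists (fun n => (L n)`_0); apply/eulerian_polynomials_rec; split=> // n.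
have nthL m i : (i <= m)%N -> (L m)`_i = (L (m - i)%N)`_0.
  by elim: m i => [|m IH] [|i] //= /IH.
by apply: eq_bigr => i _; rewrite (nthL n) // -ltnS.
Qed.

(* Q_(j,m), with every A_s evaluated at x; each part s_i is at most m. *)
Definition eulerian_Q (A : nat -> {poly R}) (x : R) (j m : nat) : R :=
  \sum_(s : {ffun 'I_j -> 'I_m.+1} |
          [forall i, (2 <= s i)%N] && (\sum_i (s i : nat) == m)%N)
    \prod_i (A (s i)).[x].

End Eulerian.

Section Solution.
Context {R : realType}.
Variables (d : nat) (lambda mu : R).

Definition G_fun (t : R) : R :=
  1 - (mu - lambda) / (mu - lambda * expR (- (mu - lambda) * t)).

Definition horizon : R := ln (mu / lambda) / (mu - lambda).

Definition solves_integral_equation (p : R -> R) : Prop :=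
  forall t, 0 < t < horizon ->
    p t = 1 - G_fun t
          - (d%:R - 1) * \int[lebesgue_measure]_(y in `[0, t])
                            (derive1 G_fun (t - y) * p y).

Variable A : nat -> {poly R}.

Definition solution_term (t : R) (n : nat) : R :=
  (- (lambda * t)) ^+ n / n`!%:R *
  \sum_(1 <= k < n.-1) (d%:R - 1) ^+ k *
    \sum_(1 <= j < n - k) 'C(k.+1, j)%:R *
      eulerian_Q A (mu / lambda) j (j + n - k - 1).

Definition solution_partial_sum (t : R) : R^nat :=
  fun N => \sum_(3 <= n < N) solution_term t n.

Definition series_solution (t : R) : R :=
  1 - d%:R *
    (1 - (mu - lambda) / (mu - lambda * expR (- (mu - lambda) * t))
     - (if d == 1%N then 0 else (* the limit as d tends to 1 *)
          (d%:R - 1)^-1 * (expR (- (lambda * t * (d%:R - 1))) - 1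
                           + lambda * t * (d%:R - 1)))
     - limn (solution_partial_sum t)).

End Solution.

(* Main.v *)
(** For x = mu / lambda the function 1 - G(t) is the generating function
    sum_n A_n(x) u^n / n! at u = - lambda t, and the renewal equation says that
    (1 - p) / d = G / (1 + (d - 1) G) for the product under which t^m / m! times
    t^n / n! is t^(m+n) / (m+n)!; expanding the geometric series, and then the
    powers of G with the linear term set apart, gives the sums over k and j.

    The integral equation.  Averaged over the arms, t |-> P_t(., 0) solves a
    one-dimensional backward equation.  With one arm the chain started at 0 has
    the geometric law pi_k(t) = (1 - G(t)) G(t)^k; pairing the forward equation
    of pi(t - s) with the backward equation at time s and integrating over s
    in [0, t] gives the equation.  Sums over k are truncated, the boundary
    term being O(K G^K).

    Convergence up to the horizon.  The series b of the A_n(x), n >= 1, has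
    nonnegative coefficients, since b' = (1 + b) (1 + x b).  Its partial sums are
    subsolutions of this equation, hence bounded by the solution up to the
    blow-up time lambda * horizon; the same holds for the renewal coefficients by
    Gronwall's inequality.  At u < 0 the partial sums solve both equations up to
    a geometrically small error, and Gronwall's inequality concludes. *)

Require Import Defs.
From mathcomp Require Import all_boot all_order all_algebra.
From mathcomp Require Import all_classical all_reals all_analysis.
From mathcomp Require Import ring lra zify.

Set Implicit Arguments.
Unset Strict Implicit.
Unset Printing Implicit Defensive.

Import Order.TTheory GRing.Theory Num.Theory.
Import numFieldNormedType.Exports.

Local Open Scope classical_set_scope.
Local Open Scope ring_scope.

(** * Integrals of continuous functions and a Gronwall inequality *)

Section Calculus.
Variable R : realType.
Implicit Types (f g F : R -> R) (s t : R).

Lemma within_itv_continuous f t :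
  (forall s, 0 <= s <= t -> {for s, continuous f}) ->
  {within `[0, t], continuous f}.
Proof.
move=> cf; apply: continuous_in_subspaceT => s; rewrite inE /= in_itv /=.
exact: cf.
Qed.

Lemma continuous_itv_integrable f t :
  (forall s, 0 <= s <= t -> {for s, continuous f}) ->
  (@lebesgue_measure R).-integrable `[0, t] (EFin \o f).
Proof.
move=> cf; apply: continuous_compact_integrable; first exact: segment_compact.
exact: within_itv_continuous.
Qed.

Lemma Rintegral_primitive F f t : 0 <= t ->
  (forall s, 0 <= s <= t -> {for s, continuous f}) ->
  (forall s, 0 <= s <= t -> {for s, continuous F}) ->
  (forall s, 0 < s < t -> is_derive s 1 F (f s)) ->
  \int[lebesgue_measure]_(y in `[0, t]) f y = F t - F 0.
Proof.
rewrite le_eqVlt => /predU1P[<- _ _ _|t0 cf cF dF].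
  by rewrite set_itv1 Rintegral_set1 subrr.
rewrite /Rintegral (@continuous_FTC2 _ f F) //.
- exact: within_itv_continuous.
- have /continuous_within_itvP : {within `[0, t], continuous F}.
    exact: within_itv_continuous.
  move=> /(_ t0)[_ F0 Ft]; split => // s; rewrite in_itv /= => st.
  by have := dF _ st; case.
- move=> s; rewrite in_itv /= => st.
  by rewrite derive1E; have := dF _ st => /@derive_val.
Qed.

Lemma le_itv_Rintegral f g t :
  (forall s, 0 <= s <= t -> {for s, continuous f}) ->
  (forall s, 0 <= s <= t -> {for s, continuous g}) ->
  (forall s, 0 <= s <= t -> f s <= g s) ->
  \int[lebesgue_measure]_(y in `[0, t]) f y <=
  \int[lebesgue_measure]_(y in `[0, t]) g y.
Proof.
move=> cf cg fg; apply: le_Rintegral => //; exact: continuous_itv_integrable.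
Qed.

Lemma continuous_norm_fun f s :
  {for s, continuous f} -> {for s, continuous (fun y => `|f y|)}.
Proof. by move=> cf; apply: (@cvg_norm _ R^o _ _ _ f). Qed.

Lemma le_norm_itv_Rintegral f g t :
  (forall s, 0 <= s <= t -> {for s, continuous f}) ->
  (forall s, 0 <= s <= t -> {for s, continuous g}) ->
  (forall s, 0 <= s <= t -> `|f s| <= g s) ->
  `|\int[lebesgue_measure]_(y in `[0, t]) f y| <=
  \int[lebesgue_measure]_(y in `[0, t]) g y.
Proof.
move=> cf cg fg; apply: le_trans.
  apply: le_normr_Rintegral => //; exact: continuous_itv_integrable.
apply: le_itv_Rintegral => // s st; apply: continuous_norm_fun; exact: cf.
Qed.

Lemma itv_Rintegral_cst (c t : R) : 0 <= t ->
  \int[lebesgue_measure]_(_ in `[0, t]) c = c * t.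
Proof.
move=> t0; rewrite Rintegral_cst //= lebesgue_measure_itv /= lte_fin.
case: ltgtP t0 => // [t0 _|<- _] /=; first by rewrite subr0.
by [].
Qed.

Lemma itv_RintegralD f g t :
  (forall s, 0 <= s <= t -> {for s, continuous f}) ->
  (forall s, 0 <= s <= t -> {for s, continuous g}) ->
  \int[lebesgue_measure]_(y in `[0, t]) (f y + g y) =
  \int[lebesgue_measure]_(y in `[0, t]) f y +
  \int[lebesgue_measure]_(y in `[0, t]) g y.
Proof. by move=> cf cg; apply: RintegralD => //; exact: continuous_itv_integrable. Qed.

Lemma itv_RintegralZ (c : R) f t :
  (forall s, 0 <= s <= t -> {for s, continuous f}) ->
  \int[lebesgue_measure]_(y in `[0, t]) (c * f y) =
  c * \int[lebesgue_measure]_(y in `[0, t]) f y.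
Proof. by move=> cf; apply: RintegralZl => //; exact: continuous_itv_integrable. Qed.

(** Functions stay in pointwise form and the value of the derivative is left as a side equation, so
    that a derivative can be presented in the shape a later step needs. *)
Lemma is_derive_addf f g s df dg d : is_derive s 1 f df -> is_derive s 1 g dg ->
  df + dg = d -> is_derive s 1 (fun y => f y + g y) d.
Proof. by move=> hf hg <-; exact: (is_deriveD hf hg). Qed.

Lemma is_derive_mulf f g s df dg d : is_derive s 1 f df -> is_derive s 1 g dg ->
  df * g s + f s * dg = d -> is_derive s 1 (fun y => f y * g y) d.
Proof.
move=> hf hg <-; have h := is_deriveM hf hg.
rewrite [X in is_derive _ _ _ X](_ : _ = f s *: dg + g s *: df) //.
by rewrite /GRing.scale /= addrC [g s * _]mulrC.
Qed.

Lemma is_derive_expf f n s df d : is_derive s 1 f df ->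
  n%:R * f s ^+ n.-1 * df = d -> is_derive s 1 (fun y => f y ^+ n) d.
Proof.
move=> hf <-; have h := is_deriveX n hf.
by have -> : (fun y => f y ^+ n) = f ^+ n by apply/funext => y; rewrite fctE.
Qed.

Lemma is_derive_mull f (c s df : R) :
  is_derive s 1 f df -> is_derive s 1 (fun y => c * f y) (c * df).
Proof.
move=> hf; apply: (is_derive_mulf (is_derive_cst c s 1) hf).
by rewrite mul0r add0r.
Qed.

Lemma is_derive_comp_mulr F (dF c s : R) :
  is_derive (c * s) 1 F dF -> is_derive s 1 (fun y => F (c * y)) (c * dF).
Proof.
move=> H; have dc := is_derive_mull c (is_derive_id s 1).
by rewrite -[X in X * dF]mulr1 mulrC; exact: (is_derive1_comp H dc).
Qed.

Lemma is_derive_rev F (dF t s : R) :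
  is_derive (t - s) 1 F dF -> is_derive s 1 (fun y => F (t - y)) (- dF).
Proof.
move=> H; have dc : is_derive s 1 (fun y => t + (-1) * y) (-1).
  apply: (is_derive_addf (is_derive_cst t s 1) (is_derive_mull (-1) (is_derive_id s 1))).
  by rewrite add0r mulr1.
have -> : (fun y => F (t - y)) = (fun y => F (t + (-1) * y)).
  by apply/funext => y; rewrite mulN1r.
have {}H : is_derive (t + (-1) * s) 1 F dF by rewrite mulN1r.
rewrite -[- dF]mulrN1.
exact: (@is_derive1_comp R F (fun y => t + (-1) * y) s dF (-1) H dc).
Qed.

Lemma is_derive_continuous F (dF s : R) :
  is_derive s 1 F dF -> {for s, continuous F}.
Proof.
by move=> [dF1 _]; apply: differentiable_continuous; apply/derivable1_diffP.
Qed.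

(* Compare [f] at the maximum of [|f s| e^(-2Ms)]. *)
Lemma gronwall f (e M t : R) : 0 <= e -> 0 <= M -> 0 <= t ->
  (forall s, 0 <= s <= t -> {for s, continuous f}) ->
  (forall s, 0 <= s <= t ->
    `|f s| <= e + M * \int[lebesgue_measure]_(y in `[0, s]) `|f y|) ->
  forall s, 0 <= s <= t -> `|f s| <= 2 * e * expR (2 * M * t).
Proof.
move=> e0 M0 t0 cf fM s /andP[s0 st].
have cexp (L y : R) : {for y, continuous (fun z => expR (L * z))}.
  exact: (is_derive_continuous (is_derive_comp_mulr (is_derive_expR (L * y)))).
(* The comparison below divides by [M]; for [M = 0] the hypothesis bounds [f] by [e] directly. *)
move: M0; rewrite le_eqVlt => /predU1P[M0|M0].
  move: (fM s); rewrite s0 st -M0 mul0r addr0 mulr0 mul0r expR0 mulr1 => /(_ erefl) h.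
  by apply: (le_trans h); rewrite mulr_natl mulr2n lerDl.
pose h y := `|f y| * expR (- (2 * M) * y).
have [|m /[!in_itv]/= /andP[m0 mt] hm] := @EVT_max R h 0 t t0.
  apply: within_itv_continuous => y yt; apply: continuousM => //.
  by apply: continuous_norm_fun; exact: cf.
have L0 : 0 < 2 * M by rewrite mulr_gt0.
have hme : h m <= 2 * e.
  have fE y : 0 <= y <= m -> `|f y| <= h m * expR (2 * M * y).
    move=> /andP[y0 ym]; rewrite -ler_pdivrMr ?expR_gt0 // -expRN -mulNr.
    by apply: hm; rewrite in_itv /= y0 (le_trans ym mt).
  have cm c y : {for y, continuous (fun z => c * expR (2 * M * z))}.
    by apply: continuousM => //; exact: cvg_cst.
  (* Integrating a majorant that grows at rate [2 * M] and multiplying by [M] leaves a factor 1/2,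
     so the integral can be absorbed by the left-hand side. *)
  have : `|f m| <= e + (h m * expR (2 * M * m) - h m) / 2.
    apply: (le_trans (fM _ _)); first by rewrite m0 mt.
    rewrite lerD2l.
    have -> : (h m * expR (2 * M * m) - h m) / 2 =
      M * ((h m / (2 * M)) * expR (2 * M * m) - (h m / (2 * M)) * expR (2 * M * 0)).
      rewrite mulr0 expR0; field; exact: lt0r_neq0.
    rewrite ler_pM2l //.
    have cM y : 0 <= y <= m -> {for y, continuous (fun z => `|f z|)}.
      move=> /andP[y0 ym]; apply: continuous_norm_fun; apply: cf.
      by rewrite y0 (le_trans ym).
    apply: (le_trans (le_itv_Rintegral cM (fun y _ => cm (h m) y) fE)).
    have dF y : 0 < y < m ->
        is_derive y 1 (fun z => (h m / (2 * M)) * expR (2 * M * z))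
          (h m * expR (2 * M * y)).
      have -> : h m * expR (2 * M * y) =
        h m / (2 * M) * (2 * M * expR (2 * M * y)).
        by field; exact: lt0r_neq0.
      by move=> _; apply: is_derive_mull; exact: is_derive_comp_mulr.
    by rewrite (Rintegral_primitive m0 (fun y _ => cm (h m) y) (fun y _ => cm _ y) dF).
  rewrite {1}(_ : `|f m| = h m * expR (2 * M * m)); last first.
    by rewrite /h mulNr -mulrA -expRD addNr expR0 mulr1.
  have h0 : 0 <= h m by rewrite /h mulr_ge0 // expR_ge0.
  have : 1 <= expR (2 * M * m).
    by rewrite -[leLHS]expR0 ler_expR mulr_ge0 // ltW.
  move=> E1 H; have : h m <= h m * expR (2 * M * m) by rewrite ler_peMr.
  lra.
have : `|f s| <= h m * expR (2 * M * s).
  rewrite -ler_pdivrMr ?expR_gt0 // -expRN -mulNr.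
  by apply: hm; rewrite in_itv /= s0 st.
move/le_trans; apply; apply: ler_pM => //.
  by rewrite /h mulr_ge0 // expR_ge0.
by rewrite ler_expR ler_wpM2l // ltW.
Qed.

End Calculus.

(** * The backward equation of a transition function *)

(** The left quotient is written as a forward increment from [s - h], since the semigroup property
    only describes what happens after a given time. *)
Lemma is_derive_lr (R : realType) (f : R -> R) (s df : R) :
  (f (s + h) - f s) / h @[h --> 0^'+] --> df ->
  (f s - f (s - h)) / h @[h --> 0^'+] --> df ->
  is_derive s 1 f df.
Proof.
move=> fr fl.
have fd : (f (s + h) - f s) / h @[h --> 0^'] --> df.
  apply: (@cvg_at_right_left_dnbhs _ R^o) => //.
  apply/cvg_at_leftNP; rewrite oppr0; apply: cvg_trans fl; apply: near_eq_cvg.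
  by near=> h; rewrite /= invrN mulrN -mulNr opprB.
have {}fd : h^-1 *: ((f \o shift s) (h *: (1 : R)) - f s) @[h --> 0^'] --> df.
  apply: cvg_trans fd; apply: near_eq_cvg; near=> h.
  by rewrite /= /GRing.scale /= mulr1 mulrC [h + s]addrC.
by apply: DeriveDef; [apply: cvgP fd | exact: (cvg_lim _ fd)].
Unshelve. all: by end_near. Qed.

Section Esum.
Context {R : realType} {S : countType}.
Implicit Types (a f : S -> R) (F : seq S).

Lemma seq_le_esum a F : uniq F -> (forall z, 0 <= a z) ->
  ((\sum_(z <- F) a z)%:E <= \esum_(z in [set: S]) (a z)%:E)%E.
Proof.
move=> uF a0; apply: esum_ge; exists [set` F].
  by split => //; exact: finite_seq.
by rewrite -fsbig_seq // sumEFin.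
Qed.

(** Outside [F] the weights [a] meet values of [f] in [0, 1], so the missing part lies between 0 and
    the missing mass; the upper bound is the lower one for [1 - f]. *)
Lemma esum_mix_bounds a f F (v : R) : uniq F -> (forall z, 0 <= a z) ->
  (forall z, 0 <= f z <= 1) ->
  \esum_(z in [set: S]) (a z)%:E = 1%E ->
  \esum_(z in [set: S]) (a z * f z)%:E = v%:E ->
  \sum_(z <- F) a z * f z <= v <=
  \sum_(z <- F) a z * f z + (1 - \sum_(z <- F) a z).
Proof.
move=> uF a0 f01 a1 av; apply/andP; split.
  rewrite -lee_fin -av; apply: seq_le_esum => // z.
  by apply: mulr_ge0 => //; case/andP: (f01 z).
have g0 z : 0 <= a z * (1 - f z).
  by apply: mulr_ge0 => //; rewrite subr_ge0; case/andP: (f01 z).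
have : ((\sum_(z <- F) a z * (1 - f z))%:E + v%:E <= 1)%E.
  rewrite -a1 -av; apply: (@le_trans _ _ (\esum_(z in [set: S])
     (a z * (1 - f z))%:E + \esum_(z in [set: S]) (a z * f z)%:E)%E).
    by apply: leeD => //; exact: seq_le_esum.
  rewrite -esumD => [|z _|z _]; last 2 first.
  - by rewrite lee_fin.
  - by rewrite lee_fin mulr_ge0 //; case/andP: (f01 z).
  by apply: le_esum => z _; rewrite -EFinD lee_fin; lra.
rewrite -EFinD lee_fin.
under eq_bigr do rewrite mulrBr mulr1.
by rewrite sumrB; lra.
Qed.

End Esum.

Lemma cvg_sum_seq (R : realType) (I : eqType) (r : seq I) (T : Type)
    (F : set_system T) {FF : Filter F} (u : I -> T -> R) (l : I -> R) :
  (forall i, i \in r -> u i x @[x --> F] --> l i) ->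
  \sum_(i <- r) u i x @[x --> F] --> \sum_(i <- r) l i.
Proof.
elim: r => [_|i r IH ul].
  rewrite big_nil; under eq_fun do rewrite big_nil; exact: cvg_cst.
rewrite big_cons; under eq_fun do rewrite big_cons.
apply: cvgD; first by apply: ul; rewrite mem_head.
by apply: IH => j jr; apply: ul; rewrite inE jr orbT.
Qed.

Section Backward.
Context {R : realType} {S : countType}.
Variables (Pt : R -> S -> S -> R) (q : S -> S -> R) (y : S).
Hypothesis PtT : transition_function Pt.
Hypothesis Ptq : has_rates Pt q.

(* [Pt] is only specified at nonnegative times, hence the truncation. *)
Definition hit (x : S) (t : R) : R := Pt (Num.max t 0) x y.

Let Pt_ge0 h x z : 0 <= h -> 0 <= Pt h x z.
Proof. by case: PtT => + _ _ _; apply. Qed.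

Let Pt_sum h x : 0 <= h -> \esum_(z in [set: S]) (Pt h x z)%:E = 1%E.
Proof. by case: PtT => _ + _ _; apply. Qed.

Lemma transition_le1 h x z : 0 <= h -> 0 <= Pt h x z <= 1.
Proof.
move=> h0; rewrite Pt_ge0 //= -lee_fin -(Pt_sum x h0).
have -> : Pt h x z = \sum_(w <- [:: z]) Pt h x w by rewrite big_seq1.
by apply: seq_le_esum => // w; exact: Pt_ge0.
Qed.

Lemma hit_ge0 x t : 0 <= hit x t <= 1.
Proof. by apply: transition_le1; rewrite le_max lexx orbT. Qed.

Lemma hit0 x : hit x 0 = (x == y)%:R.
Proof. by case: PtT => _ _ + _; rewrite /hit maxxx => ->. Qed.

(** Chapman-Kolmogorov with the time [h] spent first, so that as [h] tends to 0 the rates out of [x]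
    come into play. *)
Lemma hit_mix x F b h : uniq F -> 0 <= b -> 0 <= h ->
  \sum_(z <- F) Pt h x z * hit z b <= hit x (b + h) <=
  \sum_(z <- F) Pt h x z * hit z b + (1 - \sum_(z <- F) Pt h x z).
Proof.
move=> uF b0 h0; apply: esum_mix_bounds => //.
- by move=> z; exact: Pt_ge0.
- by move=> z; exact: hit_ge0.
- exact: Pt_sum.
- case: PtT => _ _ _ CK.
  by rewrite /hit !max_l ?addr_ge0 // addrC -CK.
Qed.

(** In [hit_mix] only the term of [x] itself is kept. *)
Lemma hit_lipschitz x b h : 0 <= b -> 0 <= h ->
  `|hit x (b + h) - hit x b| <= 1 - Pt h x x.
Proof.
move=> b0 h0; have := @hit_mix x [:: x] b h erefl b0 h0; rewrite !big_seq1.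
have := hit_ge0 x b; have := transition_le1 x x h0.
move: (hit x (b + h)) (hit x b) (Pt h x x) => v u p.
rewrite ler_norml => /andP[? ?] /andP[? ?] /andP[? ?]; apply/andP; split; nra.
Qed.

Variables (x : S) (F : seq S).
Hypothesis uF : uniq (x :: F).
Hypothesis qF : \esum_(z in [set~ x]) (q x z)%:E = (\sum_(z <- F) q x z)%:E.

Let rate_out : (1 - Pt h x x) / h @[h --> 0^'+] --> \sum_(z <- F) q x z.
Proof. by case: Ptq => _ /(_ x); rewrite qF => /fine_cvg. Qed.

Let cvg_id0 : (h : R) @[h --> 0^'+] --> 0.
Proof. by apply: (@cvg_at_right_filter R R id 0 0); exact: cvg_id. Qed.

Lemma stay_cvg : 1 - Pt h x x @[h --> 0^'+] --> 0.
Proof.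
have H : (1 - Pt h x x) / h * h @[h --> 0^'+] --> (\sum_(z <- F) q x z) * 0.
  by apply: cvgM; [exact: rate_out | exact: cvg_id0].
rewrite mulr0 in H; apply: cvg_trans H.
by apply: near_eq_cvg; near=> h; rewrite /= divfK // gt_eqF.
Unshelve. all: by end_near. Qed.

(** The modulus [1 - Pt h x x] does not depend on the base time, so one estimate for increasing
    times gives continuity from both sides; truncating times at 0 does not increase their
    distance. *)
Lemma hit_continuous : continuous (hit x).
Proof.
move=> s; apply/cvgrPdist_le => e e0.
have /cvgrPdist_le /(_ e e0) := stay_cvg.
rewrite near_simpl => -[d /= d0 dP].
have dP' h : 0 <= h < d -> 1 - Pt h x x <= e.
  move=> /andP[]; rewrite le_eqVlt => /predU1P[<- _|h0 hd].
    case: PtT => _ _ -> _; rewrite eqxx subrr; exact: ltW.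
  have /= := dP h; rewrite sub0r normrN gtr0_norm // => /(_ hd h0).
  by rewrite sub0r normrN; apply: le_trans; exact: ler_norm.
exists d => //= t /= std.
wlog : s t std / s <= t.
  move=> H; case: (leP s t) => [|/ltW] st; first exact: H.
  by rewrite distrC; apply: (H _ _ _ st); rewrite distrC.
move=> st; rewrite distrC.
have -> : hit x t = hit x (Num.max s 0 + (Num.max t 0 - Num.max s 0)).
  by rewrite addrC subrK /hit [X in _ = Pt X _ _]max_l // le_max lexx orbT.
have -> : hit x s = hit x (Num.max s 0).
  by rewrite /hit [X in _ = Pt X _ _]max_l // le_max lexx orbT.
have m0 : 0 <= Num.max s 0 by rewrite le_max lexx orbT.
move: std; rewrite [`|s - t|]distrC ger0_norm ?subr_ge0 // => std.
have tm : 0 <= Num.max t 0 - Num.max s 0 < d.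
  have trunc (u v : R) : u <= v -> v - u < d ->
      0 <= Num.max v 0 - Num.max u 0 < d.
    by move=> uv vd; rewrite !maxEle; case: ifP; case: ifP => ? ?; lra.
  exact: trunc.
apply: (le_trans (hit_lipschitz x m0 _)); first by case/andP: tm.
exact: dP'.
Qed.

Let neighbour_rate z : z \in F -> Pt h x z / h @[h --> 0^'+] --> q x z.
Proof.
case: Ptq => + _ zF; apply.
by apply: contraL zF => /eqP <-; case/andP: uF.
Qed.

(** The total rate out of [x] is carried by [F], so being outside [x :: F] after time [h] has
    probability o(h). *)
Let spill_cvg : (1 - \sum_(z <- x :: F) Pt h x z) / h @[h --> 0^'+] --> 0.
Proof.
have H : (1 - Pt h x x) / h - \sum_(z <- F) Pt h x z / h @[h --> 0^'+] -->
    \sum_(z <- F) q x z - \sum_(z <- F) q x z.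
  apply: cvgB; first exact: rate_out.
  by apply: cvg_sum_seq => z; exact: neighbour_rate.
rewrite subrr in H; apply: cvg_trans H.
apply: near_eq_cvg; near=> h; rewrite -mulr_suml -mulrBl big_cons.
by rewrite opprD addrA.
Unshelve. all: by end_near. Qed.

Hypothesis hit_cont : forall z, continuous (hit z).

(** The base point [b h] may move: [b h = s] gives the right quotient and [b h = s - h] the left
    one. The quotient is squeezed between [W h] and [W h] plus the negligible spill. *)
Let hit_increment (b : R -> R) (s : R) :
  (\forall h \near 0^'+, 0 <= b h) ->
  b h @[h --> 0^'+] --> s ->
  (hit x (b h + h) - hit x (b h)) / h @[h --> 0^'+] -->
  \sum_(z <- F) q x z * (hit z s - hit x s).
Proof.
move=> b0 bs.
have hb z : hit z (b h) @[h --> 0^'+] --> hit z s.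
  by apply: (cvg_comp b (hit z) bs); exact: hit_cont.
pose W h := \sum_(z <- F) Pt h x z / h * hit z (b h)
            - (1 - Pt h x x) / h * hit x (b h).
have Wcvg : W h @[h --> 0^'+] --> \sum_(z <- F) q x z * (hit z s - hit x s).
  under [X in _ --> X]eq_bigr do rewrite mulrBr.
  rewrite sumrB -mulr_suml; apply: cvgB.
    by apply: cvg_sum_seq => z zF; apply: cvgM; [exact: neighbour_rate | exact: hb].
  by apply: cvgM; [exact: rate_out | exact: hb].
apply: (@squeeze_cvgr _ _ _ _ W
  (fun h => W h + (1 - \sum_(z <- x :: F) Pt h x z) / h)) => //; last first.
  rewrite -[X in _ --> X]addr0; exact: cvgD.
near=> h.
have h0 : 0 < h by [].
have bh0 : 0 <= b h by near: h.
have WE : W h * h = \sum_(z <- x :: F) Pt h x z * hit z (b h) - hit x (b h).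
  rewrite /W mulrBl mulr_suml big_cons.
  rewrite (eq_bigr (fun z => Pt h x z * hit z (b h))) => [|z _]; last first.
    by rewrite mulrAC divfK ?gt_eqF.
  rewrite [X in _ - X = _]mulrAC divfK ?gt_eqF //; ring.
have := hit_mix x uF bh0 (ltW h0) => /andP[lo up].
rewrite ler_pdivlMr // WE lerD2r lo /=.
rewrite ler_pdivrMr // mulrDl WE divfK ?gt_eqF //.
by move: up; lra.
Unshelve. all: by end_near. Qed.

Lemma backward_equation (s : R) : 0 < s ->
  is_derive s 1 (hit x) (\sum_(z <- F) q x z * (hit z s - hit x s)).
Proof.
move=> s0; apply: is_derive_lr.
  apply: hit_increment; last exact: cvg_cst.
  by near=> h; exact: ltW.
have H : (hit x (s - h + h) - hit x (s - h)) / h @[h --> 0^'+] -->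
    \sum_(z <- F) q x z * (hit z s - hit x s).
  apply: (@hit_increment (fun h => s - h)).
    by near=> k; rewrite subr_ge0; near: k; exact: nbhs_right_le.
  rewrite -[X in _ --> X]subr0; apply: cvgB; [exact: cvg_cst|exact: cvg_id0].
by apply: cvg_trans H; apply: near_eq_cvg; near=> h; rewrite subrK.
Unshelve. all: by end_near. Qed.

End Backward.

Lemma esum_setC1_seq (R : realType) (S : choiceType) (x : S) (a : S -> R)
    (F : seq S) : uniq F -> x \notin F -> (forall z, 0 <= a z) ->
  (forall z, z != x -> z \notin F -> a z = 0) ->
  \esum_(z in [set~ x]) (a z)%:E = (\sum_(z <- F) a z)%:E.
Proof.
move=> uF xF a0 aF.
rewrite -sumEFin (fsbig_seq _ _ uF) -esum_fset; last 2 first.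
- exact: finite_seq.
- by move=> z _; rewrite lee_fin.
rewrite esum_mkcond [RHS]esum_mkcond; apply: eq_esum => z _.
have -> : (z \in [set` F]) = (z \in F) by apply/idP/idP; rewrite inE.
have -> : (z \in [set~ x]) = (z != x).
  by apply/idP/idP; rewrite inE /= => /eqP.
case: eqVneq => [->|zx] /=; first by rewrite (negPf xF).
by case: ifP => // /negbT zF; rewrite aF.
Qed.

(** * The chain on the star, averaged over its arms *)

Section Star.
Context {R : realType} {d : nat}.
Variables (lambda mu : R) (Pt : R -> state d -> state d -> R).
Hypotheses (d_gt0 : (0 < d)%N) (lambda_gt0 : 0 < lambda) (mu_gt0 : 0 < mu).
Hypothesis PtT : transition_function Pt.
Hypothesis Ptq : has_rates Pt (star_rate lambda lambda mu).

Local Notation u := (hit Pt origin).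
Local Notation q := (star_rate lambda lambda mu).

Definition neighbours (x : state d) : seq (state d) :=
  match x with
  | None => [seq Some (0%N, j) | j <- enum 'I_d]
  | Some (m, j) => [:: Some (m.+1, j); site m j]
  end.

Lemma neighbours_uniq x : uniq (x :: neighbours x).
Proof.
case: x => [[m j]|] /=.
  case: m => [|m] //=; rewrite !inE ?andbT negb_or -!andbA.
  by apply/and3P; split; apply/eqP => -[/eqP]; rewrite eqn_leq ?ltnn ?andbF // ltnNge leqnSn.
rewrite map_inj_uniq ?enum_uniq ?andbT; last by move=> i j [].
by apply/negP => /mapP[].
Qed.

Lemma star_rate_ge0 (x z : state d) : 0 <= q x z.
Proof.
rewrite /star_rate; case: x => [[m j]|].
  case: ifP => _; first by rewrite addr_ge0 ?mulr_ge0 ?ltW.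
  by case: ifP => _ //; rewrite mulr_ge0 ?ltW.
by case: ifP => _ //; exact: ltW.
Qed.

Lemma star_rate_out x :
  \esum_(z in [set~ x]) (q x z)%:E = (\sum_(z <- neighbours x) q x z)%:E.
Proof.
have /= /andP[xF uF] := neighbours_uniq x.
apply: esum_setC1_seq => // [z|z zx zF]; first exact: star_rate_ge0.
case: x zx zF {xF uF} => [[m j]|] /= zx zF.
  move: zF; rewrite !inE negb_or => /andP[/negPf -> /negPf zF].
  by rewrite zF.
case: ifP => // /existsP[j /eqP zE]; move: zF.
by rewrite zE (map_f (fun j => Some (0%N, j))) // mem_enum.
Qed.

Lemma hit_star_continuous x : continuous (u x).
Proof. exact: (hit_continuous PtT Ptq (star_rate_out x)). Qed.

Lemma hit_star_backward x (s : R) : 0 < s ->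
  is_derive s 1 (u x) (\sum_(z <- neighbours x) q x z * (u z s - u x s)).
Proof.
apply: backward_equation => //; first exact: neighbours_uniq.
  exact: star_rate_out.
exact: hit_star_continuous.
Qed.

(* Averaging over the arms makes the backward equation one-dimensional. *)
Definition arm_avg (k : nat) (t : R) : R :=
  d%:R^-1 * \sum_(j < d) u (site k j) t.

Let dR_neq0 : d%:R != 0 :> R.
Proof. by rewrite pnatr_eq0 -lt0n. Qed.

Lemma arm_avg0E t : arm_avg 0 t = u origin t.
Proof.
by rewrite /arm_avg /= sumr_const card_ord -[X in _ * X]mulr_natl mulKf.
Qed.

Lemma arm_avg_ge0 k t : 0 <= arm_avg k t <= 1.
Proof.
apply/andP; split.
  apply: mulr_ge0; first by rewrite invr_ge0.
  by apply: sumr_ge0 => j _; case/andP: (hit_ge0 origin PtT (site k j) t).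
rewrite ler_pdivrMl ?ltr0n // mulr1.
apply: (@le_trans _ _ (\sum_(j < d) 1)); last by rewrite sumr_const card_ord.
by apply: ler_sum => j _; case/andP: (hit_ge0 origin PtT (site k j) t).
Qed.

Lemma arm_avg_continuous k : continuous (arm_avg k).
Proof.
move=> s; apply: cvgM; first exact: cvg_cst.
by apply: cvg_sum_seq => j _; exact: hit_star_continuous.
Qed.

Lemma arm_avg_init k : arm_avg k 0 = (k == 0%N)%:R.
Proof.
case: k => [|k]; first by rewrite arm_avg0E hit0 // eqxx.
by rewrite /arm_avg big1 ?mulr0 // => j _; rewrite hit0.
Qed.

Lemma is_derive_arm_avg k (s : R) (D : 'I_d -> R) :
  (forall j, is_derive s 1 (u (site k j)) (D j)) ->
  is_derive s 1 (arm_avg k) (d%:R^-1 * \sum_(j < d) D j).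
Proof.
move=> uD; apply: is_derive_mull.
have -> : (fun t => \sum_(j < d) u (site k j) t) = \sum_(j < d) u (site k j).
  by apply/funext => t; rewrite fct_sumE.
exact: is_derive_sum.
Qed.

(** Each of the [d] arms is entered from the origin at rate [lambda], whence the factor [d]; it is
    the only trace of the number of arms in the averaged equations. *)
Lemma arm_avg_backward0 (s : R) : 0 < s ->
  is_derive s 1 (arm_avg 0) (d%:R * lambda * (arm_avg 1 s - arm_avg 0 s)).
Proof.
move=> s0.
have -> : d%:R * lambda * (arm_avg 1 s - arm_avg 0 s) =
    d%:R^-1 * \sum_(j < d) (d%:R * lambda * (arm_avg 1 s - arm_avg 0 s)).
  by rewrite sumr_const card_ord -[X in _ = _ * X]mulr_natl mulKf.
apply: is_derive_arm_avg => j /=.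
suff <- : \sum_(z <- neighbours None) q None z * (u z s - u None s) =
    d%:R * lambda * (arm_avg 1 s - arm_avg 0 s) by exact: hit_star_backward.
rewrite arm_avg0E /arm_avg big_map big_enum /=.
have qN (i : 'I_d) : [exists j : 'I_d, Some (0%N, i) == Some (0%N, j) :> state d].
  by apply/existsP; exists i.
under eq_bigr do rewrite qN.
rewrite -mulr_sumr sumrB sumr_const card_ord -[X in _ - X]mulr_natl.
by field; exact: dR_neq0.
Qed.

(** Since alpha equals [lambda], the upward rate from level k+1 is [lambda] times k+2, as for a
    linear birth process with one immigrant. *)
Lemma arm_avg_backward k (s : R) : 0 < s ->
  is_derive s 1 (arm_avg k.+1)
    (lambda * k.+2%:R * (arm_avg k.+2 s - arm_avg k.+1 s) +
     mu * k.+1%:R * (arm_avg k s - arm_avg k.+1 s)).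
Proof.
move=> s0.
have -> : lambda * k.+2%:R * (arm_avg k.+2 s - arm_avg k.+1 s) +
     mu * k.+1%:R * (arm_avg k s - arm_avg k.+1 s) =
  d%:R^-1 * \sum_(j < d) (lambda * k.+2%:R * (u (site k.+2 j) s - u (site k.+1 j) s)
     + mu * k.+1%:R * (u (site k j) s - u (site k.+1 j) s)).
  rewrite big_split /= -!mulr_sumr !sumrB /arm_avg; ring.
apply: is_derive_arm_avg => j.
have := hit_star_backward (site k.+1 j) s0.
rewrite /= big_cons big_seq1 eqxx.
(* The lower neighbour must differ from the upper one for its rate to come from the second branch of
   [star_rate]. *)
have /negPf -> : site k j != Some (k.+1, j).
  by case: k => [|k] //=; apply/eqP => -[/eqP]; rewrite ltn_eqF.
rewrite eqxx.
by rewrite [lambda * k.+2%:R](_ : _ = lambda + lambda * k.+1%:R) // -natr1; ring.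
Qed.

End Star.

(** * From the backward equation to the Volterra equation *)

Lemma geometric_le0 (R : realType) (z C x : R) : 0 <= z < 1 ->
  (forall n, x <= C * z ^+ n) -> x <= 0.
Proof.
move=> /andP[z0 z1] xC.
have H : C * z ^+ n @[n --> \oo] --> 0.
  by apply: cvg_geometric; rewrite ger0_norm.
by apply: (cvgr_to_ge H); near=> n.
Unshelve. all: by end_near. Qed.

Lemma succ_geometric_le0 (R : realType) (z C x : R) : 0 <= z < 1 -> 0 <= C ->
  (forall n, x <= C * (n.+1%:R * z ^+ n)) -> x <= 0.
Proof.
move=> /andP[z0 z1] C0 xC.
(* One factor [w ^+ n] absorbs [n.+1], because (n+1) w^n is at most the geometric sum and hence at
   most 1 / (1 - w); the other one still tends to 0. *)
pose w := Num.sqrt z.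
have w0 : 0 <= w := sqrtr_ge0 z.
have w1 : w < 1 by rewrite -sqrtr1 ltr_sqrt.
have wE : w ^+ 2 = z := sqr_sqrtr z0.
apply: (@geometric_le0 R w (C / (1 - w))); first by rewrite w0.
move=> n; apply: (le_trans (xC n)).
rewrite -mulrA ler_wpM2l // -wE -exprM mulnC exprM expr2 mulrA.
rewrite ler_wpM2r ?exprn_ge0 // -[leRHS]mulr1 ler_pdivlMl ?subr_gt0 //.
apply: (@le_trans _ _ ((1 - w) * \sum_(i < n.+1) w ^+ i)).
  rewrite ler_wpM2l ?subr_ge0 ?(ltW w1) // -[n.+1 in leLHS]card_ord mulr_natl -sumr_const.
  by apply: ler_sum => i _; apply: ler_wiXn2l => //; [exact: ltW | rewrite -ltnS].
by rewrite -opprB mulNr -subrX1 opprB gerBl exprn_ge0.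
Qed.

Section Volterra.
Variable R : realType.
Variables (d lambda mu : R) (f : nat -> R -> R) (G : R -> R).
Hypotheses (d_neq0 : d != 0) (lambda_ge0 : 0 <= lambda) (mu_ge0 : 0 <= mu).
Hypothesis f01 : forall k s, 0 <= f k s <= 1.
Hypothesis fC : forall k, continuous (f k).
Hypothesis f0 : forall k, f k 0 = (k == 0%N)%:R.
Hypothesis df0 : forall s : R, 0 < s ->
  is_derive s 1 (f 0) (d * lambda * (f 1 s - f 0 s)).
Hypothesis dfS : forall k (s : R), 0 < s ->
  is_derive s 1 (f k.+1)
    (lambda * k.+2%:R * (f k.+2 s - f k.+1 s) +
     mu * k.+1%:R * (f k s - f k.+1 s)).
Hypothesis G0 : G 0 = 0.
Hypothesis G01 : forall s : R, 0 <= s -> 0 <= G s < 1.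
Hypothesis dG : forall s : R, 0 <= s ->
  is_derive s 1 G ((1 - G s) * (lambda - mu * G s)).

Lemma volterra_of_backward (t : R) : 0 <= t ->
  f 0 t = 1 - G t - (d - 1) *
    \int[lebesgue_measure]_(y in `[0, t])
      ((1 - G (t - y)) * (lambda - mu * G (t - y)) * f 0 y).
Proof.
move=> t0.
pose g y := G (t - y).
(* The geometric law of the one-arm chain at time [t - y]. *)
pose w k y : R := (1 - g y) * g y ^+ k.
pose phi y : R := (1 - d) / d * ((1 - g y) * (lambda - mu * g y) * f 0 y).
(* The correction brings the weight of state 0 to 1/d, which compensates the rate [d * lambda] in
   [df0]; [phi] is the part of the derivative that it creates. *)
pose N K y : R := \sum_(k < K.+1) w k y * f k y + (1 - d) / d * (w 0 y * f 0 y).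
(* The net exchange between the levels K and K+1, all that the truncation leaves of the telescoping
   sum. *)
pose B K y : R := K.+1%:R * (lambda * w K y * f K.+1 y - mu * w K.+1 y * f K y).
have dg (y : R) : 0 <= y <= t -> is_derive y 1 g (- ((1 - g y) * (lambda - mu * g y))).
  by move=> /andP[_ yt]; apply: is_derive_rev; apply: dG; rewrite subr_ge0.
have cg (y : R) : 0 <= y <= t -> {for y, continuous g}.
  by move=> /dg; exact: is_derive_continuous.
have cw k (y : R) : 0 <= y <= t -> {for y, continuous (w k)}.
  move=> yt; apply: continuousM.
    by apply: continuousB; [exact: cvg_cst | exact: cg].
  exact: (continuous_comp (cg _ yt) (@exprn_continuous _ k _)).
have cphi (y : R) : 0 <= y <= t -> {for y, continuous phi}.
  move=> yt; apply: continuousM; first exact: cvg_cst.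
  apply: continuousM; last exact: fC.
  apply: continuousM; apply: continuousB; try exact: cvg_cst; first exact: cg.
  by apply: continuousM; [exact: cvg_cst | exact: cg].
have cB K (y : R) : 0 <= y <= t -> {for y, continuous (B K)}.
  move=> yt; apply: continuousM; first exact: cvg_cst.
  by apply: continuousB; apply: continuousM; try exact: fC;
    apply: continuousM; try exact: cvg_cst; exact: cw.
have cN K (y : R) : 0 <= y <= t -> {for y, continuous (N K)}.
  move=> yt; apply: continuousD.
    by apply: cvg_sum_seq => k _; apply: cvgM; [exact: cw | exact: fC].
  apply: continuousM; first exact: cvg_cst.
  by apply: continuousM; [exact: cw | exact: fC].
have dw0 (y : R) : 0 <= y <= t ->
    is_derive y 1 (w 0) ((1 - g y) * (lambda - mu * g y)).
  move=> yt; have -> : w 0 = (fun y => 1 + (-1) * g y).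
    by apply/funext => z; rewrite /w expr0 mulr1 mulN1r.
  have h1 := is_derive_mull (-1) (dg _ yt).
  have h2 : is_derive y 1 (cst (1 : R)) 0 by exact: is_derive_cst.
  apply: (is_derive_addf h2 h1).
  by rewrite add0r mulN1r opprK.
have dwS k (y : R) : 0 <= y <= t -> is_derive y 1 (w k.+1)
    ((1 - g y) * (lambda - mu * g y) * (g y ^+ k.+1 - (1 - g y) * k.+1%:R * g y ^+ k)).
  move=> yt; have -> : w k.+1 = (fun y => w 0 y * g y ^+ k.+1).
    by apply/funext => z; rewrite /w expr0 mulr1.
  have h := is_derive_expf (n := k.+1) (dg _ yt) erefl.
  apply: (is_derive_mulf (dw0 _ yt) h).
  by rewrite /w expr0 /=; ring.
have dN K (y : R) : 0 < y < t -> is_derive y 1 (N K) (phi y + B K y).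
  move=> /andP[y0 yt].
  have y0t : 0 <= y <= t by rewrite !ltW.
  (* Adding level K+1 replaces the boundary term [B K] by [B K.+1]. *)
  elim: K => [|K IH].
    have -> : N 0%N = (fun y => d^-1 * (w 0 y * f 0 y)).
      by apply/funext => z; rewrite /N big_ord1; field; exact: d_neq0.
    have h := is_derive_mulf (dw0 _ y0t) (df0 y0) erefl.
    have -> : phi y + B 0%N y = d^-1 * ((1 - g y) * (lambda - mu * g y) * f 0 y
        + w 0 y * (d * lambda * (f 1 y - f 0 y))).
      by rewrite /phi /B /w; field; exact: d_neq0.
    exact: is_derive_mull.
  have -> : N K.+1 = (fun y => N K y + w K.+1 y * f K.+1 y).
    by apply/funext => z; rewrite /N big_ord_recr /= addrAC.
  have h := is_derive_mulf (dwS K _ y0t) (dfS K y0) erefl.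
  apply: (is_derive_addf IH h).
  by rewrite /B /w !exprS -!natr1; ring.
have NE K : N K t - N K 0 =
    \int[lebesgue_measure]_(y in `[0, t]) (phi y) +
    \int[lebesgue_measure]_(y in `[0, t]) (B K y).
  rewrite -itv_RintegralD //; last exact: cB.
  rewrite (Rintegral_primitive t0 _ (cN K) (dN K)) // => y yt.
  by apply: continuousD; [exact: cphi | exact: cB].
(* At [y = t] the law is concentrated at 0 because [G 0 = 0]; at [y = 0] only [f 0] is nonzero. In
   both cases the sum reduces to its first term. *)
have Nt K : N K t = d^-1 * f 0 t.
  rewrite /N big_ord_recl big1 => [|k _].
    by rewrite /w /g /= subrr G0 !expr0; field; exact: d_neq0.
  by rewrite /w /g subrr G0 expr0n /= mulr0 mul0r.
have N0 K : N K 0 = d^-1 * (1 - G t).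
  rewrite /N big_ord_recl big1 => [|k _].
    by rewrite /w /g /= subr0 f0 !expr0 eqxx /=; field; exact: d_neq0.
  by rewrite f0 /= mulr0.
(* The maximum of [g] on the interval is a ratio below 1 that serves for all [y] at once. *)
have [|c /[!in_itv]/= /andP[c0 ct] gc] := @EVT_max R g 0 t t0.
  exact: within_itv_continuous.
have gc01 : 0 <= g c < 1 by apply: G01; rewrite subr_ge0.
have Bbound K : `|\int[lebesgue_measure]_(y in `[0, t]) (B K y)| <=
    (lambda + mu) * t * (K.+1%:R * g c ^+ K).
  rewrite (_ : (lambda + mu) * t * (K.+1%:R * g c ^+ K) =
               K.+1%:R * ((lambda + mu) * g c ^+ K) * t); last by ring.
  rewrite -itv_Rintegral_cst //; apply: le_norm_itv_Rintegral.
  - exact: cB.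
  - by move=> y _; exact: cvg_cst.
  move=> y yt; rewrite normrM normr_nat ler_wpM2l //.
  have gy01 : 0 <= g y < 1.
    by apply: G01; rewrite subr_ge0; case/andP: yt.
  have wK k : (K <= k)%N -> 0 <= w k y <= g c ^+ K.
    move=> Kk; have /andP[g0 g1] := gy01; apply/andP; split.
      by rewrite mulr_ge0 ?exprn_ge0 // subr_ge0 ltW.
    apply: (@le_trans _ _ (g y ^+ K)); last by rewrite lerXn2r // ?nnegrE ?gc //; case/andP: gc01.
    rewrite -[leRHS]mul1r; apply: ler_pM; rewrite ?exprn_ge0 //; last first.
    - by apply: ler_wiXn2l => //; exact: ltW.
    - by rewrite gerBl.
    - by rewrite subr_ge0 ltW.
  have wf k l c' : (K <= k)%N -> 0 <= c' -> `|c' * w k y * f l y| <= c' * g c ^+ K.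
    move=> Kk c'0; have /andP[a0 a1] := f01 l y; have /andP[b0 b1] := wK k Kk.
    move: b0 b1; move: (w k y) => W b0 b1.
    rewrite !normrM (ger0_norm c'0) (ger0_norm a0) (ger0_norm b0).
    by rewrite -mulrA ler_wpM2l // -[leRHS]mulr1 ler_pM.
  by apply: (le_trans (ler_normB _ _)); rewrite mulrDl lerD ?wf.
(* The difference of the two sides does not depend on [K], while the boundary integral tends to
   0. *)
have phiE : \int[lebesgue_measure]_(y in `[0, t]) (phi y) = d^-1 * (f 0 t - (1 - G t)).
  apply/eqP; rewrite -subr_eq0 -normr_le0.
  apply: (succ_geometric_le0 (z := g c) (C := (lambda + mu) * t)) => //.
    by rewrite mulr_ge0 // addr_ge0.
  move=> K; apply: le_trans (Bbound K).
  move: (NE K); rewrite Nt N0 -mulrBr => ->.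
  by rewrite opprD addNKr normrN.
move: phiE; rewrite /phi itv_RintegralZ; last first.
  move=> y yt.
  apply: continuousM; last exact: fC.
  apply: continuousM; apply: continuousB; try exact: cvg_cst; first exact: cg.
  by apply: continuousM; [exact: cvg_cst | exact: cg].
set I := Rintegral _ _ _ => /(congr1 (fun x => d * x)).
rewrite [in RHS]mulVKf // => E.
have -> : f 0 t = 1 - G t + (f 0 t - (1 - G t)) by ring.
by rewrite -E; field; exact: d_neq0.
Qed.

End Volterra.

(** * The function G and its Riccati equation *)

Section Kernel.
Variables (R : realType) (lambda mu : R).
Hypotheses (lambda_gt0 : 0 < lambda) (mu_neq : mu != lambda).

Local Notation G := (G_fun lambda mu).
Let den (s : R) := mu - lambda * expR (- (mu - lambda) * s).

(** The quotient is [1 - G s]. Numerator and denominator have the same sign, and the denominator is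
    at least as large in absolute value; the two signs of [mu - lambda] are treated separately. *)
Let den_bounds (s : R) : 0 <= s ->
  den s != 0 /\ 0 < (mu - lambda) / den s <= 1.
Proof.
move=> s0; rewrite /den.
have [lt|lt|/esym/eqP] := ltgtP lambda mu; last by rewrite (negPf mu_neq).
  have e1 : expR (- (mu - lambda) * s) <= 1.
    by rewrite -[leRHS]expR0 ler_expR mulNr oppr_le0 mulr_ge0 // subr_ge0 ltW.
  have den_ge : mu - lambda <= mu - lambda * expR (- (mu - lambda) * s).
    by rewrite lerD2l lerN2 ler_piMr // ltW.
  have c0 : 0 < mu - lambda by rewrite subr_gt0.
  have d0 := lt_le_trans c0 den_ge.
  by rewrite gt_eqF // divr_gt0 //= ler_pdivrMr // mul1r.
have e1 : 1 <= expR (- (mu - lambda) * s).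
  by rewrite -[leLHS]expR0 ler_expR opprB mulr_ge0 // subr_ge0 ltW.
have den_le : mu - lambda * expR (- (mu - lambda) * s) <= mu - lambda.
  by rewrite lerD2l lerN2 ler_peMr // ltW.
have c0 : mu - lambda < 0 by rewrite subr_lt0.
have d0 := le_lt_trans den_le c0.
split; first by rewrite lt_eqF.
by rewrite ltr_ndivlMr // mul0r c0 /= ler_ndivrMr // mul1r.
Qed.

Lemma G_fun0 : G 0 = 0.
Proof.
by rewrite /G_fun mulr0 expR0 mulr1 divff ?subrr // subr_eq0.
Qed.

Lemma G_fun_bounds (s : R) : 0 <= s -> 0 <= G s < 1.
Proof.
by move=> /den_bounds[_ /andP[a b]]; rewrite /G_fun subr_ge0 b gtrBl a.
Qed.

(** This Riccati equation is exactly what makes the geometric law of parameter [G] solve the forward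
    equation of the one-arm chain. *)
Lemma is_derive_G_fun (s : R) : 0 <= s ->
  is_derive s 1 G ((1 - G s) * (lambda - mu * G s)).
Proof.
move=> s0; have [dn _] := den_bounds s0.
pose e (y : R) := expR (- (mu - lambda) * y).
have he : is_derive s 1 e (- (mu - lambda) * e s).
  exact: (is_derive_comp_mulr (is_derive_expR (- (mu - lambda) * s))).
have hd : is_derive s 1 den (- lambda * (- (mu - lambda) * e s)).
  have -> : den = (fun y => mu + (- lambda) * e y).
    by apply/funext => y; rewrite mulNr.
  apply: (is_derive_addf (is_derive_cst mu s 1) (is_derive_mull (- lambda) he)).
  exact: add0r.
have hv := is_deriveV dn hd.
have hm := is_derive_mull (- (mu - lambda)) hv.
have -> : G = (fun y => 1 + (- (mu - lambda)) * (den y)^-1).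
  by apply/funext => y; rewrite mulNr.
have h1 : is_derive s 1 (cst (1 : R)) 0 by exact: is_derive_cst.
apply: (is_derive_addf h1 hm).
move: dn; rewrite /G_fun /GRing.scale /= /den -/(e s) => dn.
by field.
Qed.

Lemma derive1_G_fun (s : R) : 0 <= s ->
  (G^`()%classic) s = (1 - G s) * (lambda - mu * G s).
Proof. by move=> /is_derive_G_fun H; rewrite derive1E; apply: derive_val. Qed.

End Kernel.

Section Emptiness.
Context (R : realType) (d : nat) (lambda mu : R).
Context (disp : measure_display) (T : measurableType disp) (P : probability T R).
Variable X : R -> T -> state d.
Hypotheses (d_gt0 : (0 < d)%N) (lambda_gt0 : 0 < lambda) (mu_gt0 : 0 < mu).
Hypothesis mu_neq : mu != lambda.
Hypothesis X_chain : markov_chain P X origin (star_rate lambda lambda mu).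

Local Notation G := (G_fun lambda mu).

(** A function [f] continuous on the whole line stands in for the return probability, with which it
    agrees at nonnegative times. The identification is the Markov property with empty history at
    time 0. *)
Lemma emptiness_volterra : exists f : R -> R,
  [/\ continuous f, forall s, 0 <= f s <= 1, f 0 = 1,
      forall s : R, 0 <= s -> return_probability P X origin s = f s &
      forall t : R, 0 <= t -> f t = 1 - G t - (d%:R - 1) *
        \int[lebesgue_measure]_(y in `[0, t])
          ((1 - G (t - y)) * (lambda - mu * G (t - y)) * f y)].
Proof.
case: X_chain => _ X0 [Pt [PtT Ptq XP]].
have d_neq0 : d%:R != 0 :> R by rewrite pnatr_eq0 -lt0n.
exists (arm_avg Pt 0); split.
- exact: (arm_avg_continuous lambda_gt0 mu_gt0 PtT Ptq).
- by move=> s; exact: arm_avg_ge0.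
- by rewrite arm_avg_init.
- move=> s s0; rewrite arm_avg0E // /return_probability /hit max_l // X0 divr1.
  have := XP [::] 0 s origin origin (lexx 0) s0 erefl.
  have -> : history X [::] = setT by apply/seteqP; split.
  by rewrite setTI add0r X0 mul1e setIC => ->.
have f01 k s : 0 <= arm_avg Pt k s <= 1 by exact: arm_avg_ge0.
have fC := arm_avg_continuous lambda_gt0 mu_gt0 PtT Ptq.
have f0 k : arm_avg Pt k 0 = (k == 0%N)%:R by exact: arm_avg_init.
have df0 (s : R) (s0 : 0 < s) := arm_avg_backward0 d_gt0 lambda_gt0 mu_gt0 PtT Ptq s0.
have dfS k (s : R) (s0 : 0 < s) := arm_avg_backward lambda_gt0 mu_gt0 PtT Ptq k s0.
have G0 := G_fun0 mu_neq.
have G01 := G_fun_bounds lambda_gt0 mu_neq.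
have dG := is_derive_G_fun lambda_gt0 mu_neq.
exact: (volterra_of_backward d_neq0 (ltW lambda_gt0) (ltW mu_gt0) f01 fC f0 df0 dfS G0 G01 dG).
Qed.

End Emptiness.

(** * The differential equation of the Eulerian generating function *)

Section PolyLow.
Variable R : fieldType.
Implicit Types p q : {poly R}.

(** Identities between truncated series are handled as congruences modulo ['X^N]. *)
Lemma dvdXn_coefP N p : reflect (forall i, (i < N)%N -> p`_i = 0) ('X^N %| p).
Proof.
apply: (iffP idP) => [/dvdpP[q ->] i iN|pN]; first by rewrite coefMXn iN.
rewrite -(poly_take_drop N p) (_ : take_poly N p = 0) ?add0r ?dvdp_mull //.
by apply/polyP => i; rewrite coef_take_poly coef0; case: ifP => // /pN.
Qed.

Lemma coef_exp_eq p q n : (forall i, (i <= n)%N -> p`_i = q`_i) ->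
  forall k i, (i <= n)%N -> (p ^+ k)`_i = (q ^+ k)`_i.
Proof.
move=> pq; elim=> [|k IH] i ile; first by rewrite !expr0.
rewrite !exprS !coefM; apply: eq_bigr => j _.
rewrite pq ?IH //; first exact: leq_trans (leq_subr _ _) ile.
by apply: leq_trans ile; rewrite -ltnS.
Qed.

Lemma coef_exp_low p n k : p`_0 = 0 -> (n < k)%N -> (p ^+ k)`_n = 0.
Proof.
move=> p0 nk; apply: (elimT (dvdXn_coefP k _)) => //.
have H : 'X^1 %| p by apply/dvdXn_coefP => -[|i].
exact: (dvdp_exp2r k H).
Qed.

End PolyLow.

Section EulerianODE.
Variables (R : realType) (A : nat -> {poly R}) (x : R).
Hypothesis A_eulerian : eulerian_polynomials A.

Local Notation a n := (A n).[x].

Definition eulerian_egf (N : nat) : {poly R} :=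
  \poly_(i < N.+1) (if i == 0%N then 0 else a i / i`!%:R).

Local Notation b := eulerian_egf.

Lemma eulerian_value0 : a 0%N = 1.
Proof. by have [-> _ _ _] := eulerian_polynomials_small A_eulerian; rewrite hornerE. Qed.

Lemma eulerian_value1 : a 1%N = 1.
Proof. by have [_ -> _ _] := eulerian_polynomials_small A_eulerian; rewrite hornerE. Qed.

Let fact_neq0 n : n`!%:R != 0 :> R.
Proof. by rewrite pnatr_eq0 -lt0n fact_gt0. Qed.

Let factS n : n.+1`!%:R = n.+1%:R * n`!%:R :> R.
Proof. by rewrite -natrM factS. Qed.

Let c := x - 1.
Hypothesis x_neq1 : x != 1.

(* With [a] the generating function and [F = x - e^(cu)], the relations [F a = c] and
   [F' = c (F - x)] give [c a' = c (x a^2 - c a)]. *)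
Lemma eulerian_ode_low N :
  'X^N %| (b N)^`() - (1 + b N) * (1 + x *: b N).
Proof.
pose al : {poly R} := \poly_(i < N.+1) (a i / i`!%:R).
pose F : {poly R} := \poly_(i < N.+1) (x * (i == 0%N)%:R - c ^+ i / i`!%:R).
have alE : al = 1 + b N.
  apply/polyP => i; rewrite coefD !coef_poly coef1; case: i => [|i] /=.
    by rewrite eulerian_value0 fact0 divr1 addr0.
  by rewrite add0r.
(* The defining relation of the Eulerian polynomials, evaluated at [x]. *)
have Fal : 'X^(N.+1) %| F * al - c%:P.
  apply/dvdXn_coefP => n nN; rewrite coefB coefC coefM.
  have /(congr1 (fun p : {poly R} => p.[x])) := A_eulerian n.
  rewrite /series_mul horner_sum hornerMn !hornerE -/c => E.
  apply/eqP; rewrite subr_eq0; apply/eqP.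
  transitivity (c *+ (n == 0%N)); last by case: (n).
  rewrite -E; apply: eq_bigr => j _.
  rewrite !coef_poly (leq_trans (ltn_ord j)) // ltnS (leq_trans (leq_subr _ _)) //.
  rewrite hornerM hornerD hornerN hornerMn hornerX /series_exp !hornerZ horner_exp.
  rewrite !hornerE -/c mulr_natr /= [c ^+ j / _]mulrC; exact: mulrAC.
(* Differentiation costs one order of vanishing. *)
have dFal : 'X^N %| F^`() * al + F * al^`().
  rewrite -derivM; have -> : (F * al)^`() = (F * al - c%:P)^`().
    by rewrite derivB derivC subr0.
  apply/dvdXn_coefP => i iN; rewrite coef_deriv.
  by move/dvdXn_coefP: Fal => -> //; rewrite mul0rn.
have dF : 'X^N %| F^`() - c *: (F - x%:P).
  apply/dvdXn_coefP => i iN; rewrite coefB coefZ coefB coef_deriv coefC !coef_poly.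
  rewrite ltnS iN (leq_trans iN) //= mulr0 sub0r -[X in X - _]mulr_natr.
  rewrite factS exprS.
  have m0 : i.+1%:R != 0 :> R by rewrite pnatr_eq0.
  move: (i.+1%:R) m0 (i`!%:R) (fact_neq0 i) (c ^+ i) => m m0 f f0 ci.
  case: (i == 0%N) => /=; rewrite ?mulr1n ?mulr0n /c; field; by rewrite f0 m0.
have Fal' : 'X^N %| F * al - c%:P.
  by apply: dvdp_trans Fal; rewrite dvdp_exp2l.
have bE : b N = al - 1 by rewrite alE addrC addKr.
have c0 : c != 0 by rewrite subr_eq0.
rewrite bE -(dvdpZr _ _ c0).
(* An explicit combination of the three congruences; each summand is then divisible by ['X^N]. *)
have -> : c *: ((al - 1)^`() - (1 + (al - 1)) * (1 + x *: (al - 1))) =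
  - al^`() * (F * al - c%:P) + al * (F^`() * al + F * al^`())
  - al ^+ 2 * (F^`() - c *: (F - x%:P)) - c%:P * al * (F * al - c%:P).
  have d1 : (1 : {poly R})^`() = 0 by rewrite -polyC1 derivC.
  rewrite derivB d1 -!mul_polyC /c polyCB polyC1; ring.
apply: dvdp_sub; last exact: dvdp_mull.
apply: dvdp_sub; last exact: dvdp_mull.
by apply: dvdp_add; exact: dvdp_mull.
Qed.

Hypothesis x_ge0 : 0 <= x.

Lemma coef_eulerian_egf N i :
  (b N)`_i = if (0 < i <= N)%N then a i / i`!%:R else 0.
Proof. by rewrite coef_poly ltnS; case: i => [|i] //=; case: ifP. Qed.

Lemma eulerian_ode_coef N i : (i < N)%N ->
  a i.+1 / i`!%:R = ((1 + b N) * (1 + x *: b N))`_i.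
Proof.
move=> iN; have /dvdXn_coefP /(_ i iN) := eulerian_ode_low N.
rewrite coefB coef_deriv coef_eulerian_egf iN /= => /eqP.
rewrite subr_eq0 => /eqP <-; rewrite factS -[X in _ = X]mulr_natr.
have m0 : i.+1%:R != 0 :> R by rewrite pnatr_eq0.
move: (i.+1%:R) m0 (i`!%:R) (fact_neq0 i) => m m0 f f0.
by field; rewrite f0 m0.
Qed.

(** The differential equation expresses each value through the earlier ones with nonnegative
    coefficients. *)
Lemma eulerian_value_ge0 n : 0 <= a n.
Proof.
have [m] := ubnP n; elim: m n => // m IH [_|n nm]; first by rewrite eulerian_value0.
have : 0 <= a n.+1 / n`!%:R.
  rewrite (eulerian_ode_coef (ltnSn n)) coefM; apply: sumr_ge0 => j _.
  have pos i : (i <= n)%N -> 0 <= (b n.+1)`_i.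
    move=> ile; rewrite coef_eulerian_egf; case: ifP => // _.
    by apply: divr_ge0 => //; apply: IH; exact: leq_ltn_trans ile nm.
  have jn : (j <= n)%N by rewrite -ltnS.
  apply: mulr_ge0; rewrite coefD coef1 ?coefZ addr_ge0 ?mulr_ge0 ?pos ?leq_subr //.
by rewrite pmulr_lge0 // invr_gt0 ltr0n fact_gt0.
Qed.

Lemma eulerian_egf_ge0 N i : 0 <= (b N)`_i.
Proof.
by rewrite coef_eulerian_egf; case: ifP => // _; rewrite divr_ge0 ?eulerian_value_ge0.
Qed.

Lemma eulerian_egf_rhs_ge0 N i : 0 <= ((1 + b N) * (1 + x *: b N))`_i.
Proof.
rewrite coefM; apply: sumr_ge0 => j _; apply: mulr_ge0.
  by rewrite coefD coef1 addr_ge0 ?eulerian_egf_ge0.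
by rewrite coefD coef1 coefZ addr_ge0 ?mulr_ge0 ?eulerian_egf_ge0.
Qed.

Definition ode_defect N : {poly R} := (1 + b N) * (1 + x *: b N) - (b N)^`().

Lemma ode_defect_low N i : (i < N)%N -> (ode_defect N)`_i = 0.
Proof.
move=> iN; have /dvdXn_coefP /(_ i iN) := eulerian_ode_low N.
by rewrite /ode_defect !coefB => /eqP; rewrite subr_eq0 => /eqP ->; rewrite subrr.
Qed.

(** Below degree N the defect vanishes; from there on the derivative of the truncation has no
    coefficient, and the defect is the whole right-hand side. *)
Lemma ode_defect_bounds N i :
  0 <= (ode_defect N)`_i <= ((1 + b N) * (1 + x *: b N))`_i.
Proof.
have [iN|Ni] := ltnP i N; first by rewrite ode_defect_low // eulerian_egf_rhs_ge0 lexx.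
have -> : (ode_defect N)`_i = ((1 + b N) * (1 + x *: b N))`_i.
  by rewrite coefB coef_deriv coef_eulerian_egf /= ltnNge Ni mul0rn subr0.
by rewrite eulerian_egf_rhs_ge0 lexx.
Qed.

End EulerianODE.

(** * Renewal coefficients and their expansion *)

Lemma big_nat_vanish (R : nmodType) (T : nat -> R) (m L : nat) : (m <= L)%N ->
  (forall j, (m <= j)%N -> T j = 0) ->
  \sum_(0 <= j < L) T j = \sum_(0 <= j < m) T j.
Proof.
move=> mL T0; rewrite (big_cat_nat (leq0n m) mL) /= [X in _ + X]big_nat_cond.
by rewrite [X in _ + X]big1 ?addr0 // => j /andP[/andP[/T0]].
Qed.

Section Renewal.
Variables (R : fieldType) (a : nat -> R) (D : R).

Definition renewal_ogf (M : nat) : {poly R} :=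
  \poly_(i < M) (if i == 0%N then 0 else a i).

(* the coefficients of P + D P^2 + D^2 P^3 + ..., where P = sum_(i >= 1) a_i X^i *)
Definition renewal_coef (n : nat) : R :=
  \sum_(k < n) D ^+ k * (renewal_ogf n.+1 ^+ k.+1)`_n.

Local Notation p := renewal_ogf.
Local Notation E := renewal_coef.

Let p_coef0 M : (p M)`_0 = 0.
Proof. by rewrite coef_poly; case: ifP. Qed.

(** The polynomial has no constant term, so only its first n powers reach degree n, and its
    coefficients above n do not matter. *)
Lemma renewal_coef_trunc n M K : (n < M)%N -> (n <= K)%N ->
  E n = \sum_(k < K) D ^+ k * (p M ^+ k.+1)`_n.
Proof.
move=> nM nK; rewrite -(big_mkord xpredT (fun k => D ^+ k * (p M ^+ k.+1)`_n)).
rewrite (big_cat_nat (leq0n n) nK) /= [X in _ + X]big_nat_cond.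
rewrite [X in _ + X]big1 => [|k /andP[/andP[nk _] _]]; last first.
  by rewrite coef_exp_low ?mulr0.
rewrite addr0 big_mkord; apply: eq_bigr => k _; congr (_ * _).
apply: (@coef_exp_eq _ _ _ n) => // i ile.
by rewrite !coef_poly ltnS ile (leq_ltn_trans ile).
Qed.

Lemma renewal_coef0 : E 0%N = 0.
Proof. by rewrite /E big_ord0. Qed.

(** Splitting one factor off each power turns the geometric series into a renewal recursion. *)
Lemma renewal_coefS n : E n.+1 = a n.+1 +
  D * \sum_(i < n.+2) (if i == 0%N :> nat then 0 else a i) * E (n.+1 - i).
Proof.
rewrite {1}/E big_ord_recl expr0 mul1r expr1 coef_poly ltnSn /=; congr (_ + _).
transitivity (\sum_(k < n) \sum_(i < n.+2) D *
    ((if i == 0%N :> nat then 0 else a i) * (D ^+ k * (p n.+2 ^+ k.+1)`_(n.+1 - i)))).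
  apply: eq_bigr => k _; rewrite /bump add1n exprS [p _ ^+ _.+2]exprS coefM mulr_sumr.
  by apply: eq_bigr => i _; rewrite coef_poly ltn_ord; ring.
rewrite exchange_big mulr_sumr; apply: eq_bigr => i _ /=.
rewrite -!mulr_sumr; congr (_ * _).
case: (i =P 0%N :> nat) => [_|/eqP i0]; first by rewrite !mul0r.
by rewrite -(@renewal_coef_trunc _ n.+2 n) //; lia.
Qed.

Lemma coef_prod_sum_monom (c : nat -> R) m j :
  ((\poly_(i < m.+1) c i) ^+ j)`_m =
  \sum_(s : {ffun 'I_j -> 'I_m.+1} | (\sum_i (s i : nat) == m)%N) \prod_i c (s i).
Proof.
have -> : (\poly_(i < m.+1) c i) ^+ j =
    \sum_(s : {ffun 'I_j -> 'I_m.+1}) (\prod_i c (s i)) *: 'X^(\sum_i s i)%N.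
  rewrite -[in LHS](card_ord j) -prodr_const poly_def bigA_distr_bigA /=.
  apply: eq_bigr => s _; rewrite scaler_prod; congr (_ *: _).
  by rewrite -prodrXr.
rewrite coef_sum [RHS]big_mkcond; apply: eq_bigr => s _ /=.
by rewrite coefZ coefXn eq_sym; case: eqP => _; rewrite ?mulr1 ?mulr0.
Qed.

Hypothesis a1 : a 1%N = 1.

Let B (M : nat) : {poly R} := \poly_(i < M) (if (i < 2)%N then 0 else a i).

Let coef_B_exp_low M j m : (m < 2 * j)%N -> (B M ^+ j)`_m = 0.
Proof.
apply: (elimT (dvdXn_coefP _ _)); rewrite exprM dvdp_exp2r //.
by apply/dvdXn_coefP => i i2; rewrite coef_poly i2 if_same.
Qed.

(** The binomial expansion of (X + B)^(k+1): the factor X^(k+1-j) shifts the coefficient index from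
    n to j + n - k - 1. *)
Let coef_p_exp n M k : (k < n)%N -> (n < M)%N -> (p M ^+ k.+1)`_n =
  \sum_(0 <= j < k.+2) 'C(k.+1, j)%:R * (B M ^+ j)`_(j + n - k - 1).
Proof.
move=> kn nM.
have M1 : (1 < M)%N by lia.
have -> : p M = 'X + B M.
  apply/polyP => i; rewrite coefD coefX !coef_poly.
  by case: i => [|[|i]] /=; rewrite ?M1 ?a1 ?if_same ?addr0 ?add0r.
rewrite exprDn coef_sum big_mkord; apply: eq_bigr => j _.
have jk : (j <= k.+1)%N by rewrite -ltnS.
rewrite coefMn -[LHS]mulr_natl; congr (_ * _); rewrite coefXnM.
rewrite ltnNge (leq_trans (leq_subr _ _) kn) /=; congr (_ `_ _).
lia.
Qed.

(* Writing P = X + B and expanding P^(k+1), the terms in which B does not occur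
   contribute D^(n-1). *)
Lemma renewal_coef_expand n M : (2 < n < M)%N ->
  E n = a n + D ^+ n.-1 + \sum_(1 <= k < n.-1) D ^+ k *
    \sum_(1 <= j < n - k) 'C(k.+1, j)%:R * (B M ^+ j)`_(j + n - k - 1).
Proof.
case: n => [|[|[|n]]] //= nM; rewrite (renewal_coef_trunc nM (leqnn _)).
rewrite -(big_mkord xpredT (fun k => D ^+ k * (p M ^+ k.+1)`_n.+3)).
rewrite big_nat_recr // big_ltn //= expr0 mul1r expr1 coef_poly nM /=.
rewrite -addrA -[RHS]addrA; congr (_ + _); rewrite addrC; congr (_ + _).
  (* For k = n - 1 the index equals j, and B^j has no term of degree j unless j = 0. *)
  rewrite coef_p_exp // big_ltn // bin0 mul1r expr0 add0n subSnn subn1 /= coef1 mulr1n.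
  rewrite big_nat_cond big1 ?addr0 ?mulr1 // => j /andP[/andP[j0 _] _].
  by rewrite coef_B_exp_low ?mulr0 //; lia.
rewrite big_nat_cond [RHS]big_nat_cond; apply: eq_bigr => k /andP[/andP[k1 kn] _].
rewrite coef_p_exp //; last lia.
congr (_ * _).
pose T j := 'C(k.+1, j)%:R * (B M ^+ j)`_(j + n.+3 - k - 1).
have nk : (0 < n.+3 - k)%N by lia.
(* The two ranges of j are compared inside a common larger one: binomials vanish for j > k + 1, and
   coefficients of B^j vanish as soon as j reaches the upper bound of the other range. *)
have mL : (k.+2 <= n.+4 + k)%N by lia.
have nL : (n.+3 - k <= n.+4 + k)%N by lia.
rewrite -/(T _) -(big_nat_vanish mL) => [|j kj]; last by rewrite /T bin_small ?mul0r.
rewrite (big_nat_vanish nL) => [|j nj]; last first.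
  by rewrite /T coef_B_exp_low ?mulr0 //; lia.
rewrite [LHS]big_ltn // bin0 mul1r expr0 add0n coef1.
by rewrite (_ : (_ == 0)%N = false) ?mulr0n ?add0r //; lia.
Qed.

End Renewal.

Section EulerianRenewal.
Variables (R : realType) (A : nat -> {poly R}) (x : R).
Hypothesis A_eulerian : eulerian_polynomials A.

(** Expanding the power lists all choices of parts; deleting the coefficients of degree 0 and 1
    enforces that every part is at least 2. *)
Lemma eulerian_QE M j m : (m < M)%N -> eulerian_Q A x j m =
  ((\poly_(i < M) (if (i < 2)%N then 0 else (A i).[x])) ^+ j)`_m.
Proof.
move=> mM; pose c i := if (i < 2)%N then 0 else (A i).[x].
transitivity (((\poly_(i < m.+1) c i) ^+ j)`_m); last first.
  apply: (@coef_exp_eq _ _ _ m) => // i im.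
  by rewrite !coef_poly ltnS im (leq_ltn_trans im).
rewrite coef_prod_sum_monom /eulerian_Q big_mkcond [RHS]big_mkcond.
apply: eq_bigr => s _ /=; case: ifP => [/andP[/forallP s2 ->]|].
  by apply: eq_bigr => i _; rewrite /c ltnNge s2.
move=> /negbT; rewrite negb_and => /orP[|/negPf -> //].
move=> /forallPn[i]; rewrite -ltnNge => i2; case: ifP => // _.
by rewrite (bigD1 i) //= /c i2 mul0r.
Qed.

Lemma renewal_coef_eulerian (D : R) n : (2 < n)%N ->
  \sum_(1 <= k < n.-1) D ^+ k *
    \sum_(1 <= j < n - k) 'C(k.+1, j)%:R * eulerian_Q A x j (j + n - k - 1) =
  renewal_coef (fun i => (A i).[x]) D n - (A n).[x] - D ^+ n.-1.
Proof.
(* The truncation order 2n + 1 exceeds every index j + n - k - 1 that occurs. *)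
move=> n2; have n2M : (2 < n < (n + n).+1)%N by lia.
rewrite (renewal_coef_expand _ (eulerian_value1 x A_eulerian) n2M).
rewrite [X in _ = X - _ - _]addrC -addrA -opprD addrK.
rewrite big_nat_cond [RHS]big_nat_cond; apply: eq_bigr => k /andP[/andP[k1 kn] _].
congr (_ * _); rewrite big_nat_cond [RHS]big_nat_cond.
apply: eq_bigr => j /andP[/andP[j1 jn] _]; congr (_ * _).
by apply: eulerian_QE; lia.
Qed.

End EulerianRenewal.

(** * Convergence of the power series *)

Section NonnegativePoly.
Variable R : realType.
Implicit Types p q : {poly R}.

Lemma horner_ge0 p (y : R) : (forall i, 0 <= p`_i) -> 0 <= y -> 0 <= p.[y].
Proof.
by move=> p0 y0; rewrite horner_coef sumr_ge0 // => i _; rewrite mulr_ge0 ?exprn_ge0.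
Qed.

Lemma horner_coef_le p q (y : R) :
  (forall i, p`_i <= q`_i) -> 0 <= y -> p.[y] <= q.[y].
Proof.
move=> pq y0; rewrite -subr_ge0 -hornerN -hornerD horner_ge0 // => i.
by rewrite coefB subr_ge0.
Qed.

(** Each monomial of degree at least N gains a factor [th ^+ N]. All geometric error bounds below
    rest on this. *)
Lemma norm_horner_low p N (y z th : R) : (forall i, 0 <= p`_i) ->
  (forall i, (i < N)%N -> p`_i = 0) -> 0 <= th <= 1 -> 0 <= z -> `|y| <= th * z ->
  `|p.[y]| <= th ^+ N * p.[z].
Proof.
move=> p0 pN /andP[th0 th1] z0 yz; rewrite !horner_coef mulr_sumr.
apply: (le_trans (ler_norm_sum _ _ _)); apply: ler_sum => i _.
have [iN|Ni] := ltnP i N; first by rewrite pN // !mul0r mulr0 normr0.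
rewrite normrM ger0_norm // normrX mulrCA ler_wpM2l //.
apply: (@le_trans _ _ (th ^+ i * z ^+ i)).
  by rewrite -exprMn lerXn2r // ?nnegrE ?mulr_ge0.
by rewrite ler_wpM2r ?exprn_ge0 // ler_wiXn2l.
Qed.

Lemma norm_horner_le p (y z : R) : (forall i, 0 <= p`_i) -> `|y| <= z ->
  `|p.[y]| <= p.[z].
Proof.
move=> p0 yz; have z0 : 0 <= z := le_trans (normr_ge0 y) yz.
have := @norm_horner_low p 0 y z 1 p0.
by rewrite expr0 !mul1r; apply; rewrite ?ler01 ?lexx.
Qed.

Lemma is_derive_horner_scale p (c s : R) :
  is_derive s 1 (fun y => p.[c * y]) (c * p^`().[c * s]).
Proof. by apply: is_derive_comp_mulr; exact: is_derive_poly. Qed.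

Lemma horner_scale_continuous p (c : R) : continuous (fun y => p.[c * y]).
Proof. by move=> s; exact: (is_derive_continuous (is_derive_horner_scale p c s)). Qed.

End NonnegativePoly.

Section EulerianBound.
Variables (R : realType) (A : nat -> {poly R}) (x : R).
Hypotheses (A_eulerian : eulerian_polynomials A) (x_neq1 : x != 1) (x_ge0 : 0 <= x).

Local Notation b := (eulerian_egf A x).
Let c := x - 1.
Let c_neq0 : c != 0. Proof. by rewrite subr_eq0. Qed.

(* The truncation S satisfies S' <= (1 + S) (1 + x S), so that
   (x - 1) (1 + x S) / (1 + S) e^(-(x - 1) u) decreases; the bound is the solution
   of the corresponding equation. *)
Lemma eulerian_egf_bound N (v : R) : 0 <= v -> 0 < (x - expR (c * v)) / c ->
  (b N).[v] <= (expR (c * v) - 1) / (x - expR (c * v)).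
Proof.
move=> v0 w0.
have b0 := eulerian_egf_ge0 A_eulerian x_neq1 x_ge0 N.
have S0 (u : R) : 0 <= u -> 0 <= (b N).[u] by exact: horner_ge0.
have S1 (u : R) : 0 <= u -> 1 + (b N).[u] != 0.
  by move=> /S0 ?; rewrite gt_eqF // ltr_pwDl.
pose dS (u : R) := (b N)^`().[u].
pose psi (u : R) : R := (1 + x * (b N).[u]) * (expR (- c * u) * (1 + (b N).[u])^-1).
pose dpsi (u : R) : R :=
  c * expR (- c * u) / (1 + (b N).[u]) ^+ 2 *
    (dS u - (1 + (b N).[u]) * (1 + x * (b N).[u])).
have d1 (k u : R) : is_derive u 1 (fun y => 1 + k * (b N).[y]) (k * dS u).
  have h1 : is_derive u 1 (cst (1 : R)) 0 by exact: is_derive_cst.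
  have h2 := is_derive_mull k (is_derive_poly (b N) u).
  by apply: (is_derive_addf h1 h2); rewrite add0r.
have dpsiE (u : R) : 0 <= u -> is_derive u 1 psi (dpsi u).
  move=> u0.
  have h1 := is_derive_comp_mulr (is_derive_expR (- c * u)).
  have h2 : is_derive u 1 (fun y => 1 + (b N).[y]) (dS u).
    have := d1 1 u; rewrite mul1r; under [X in is_derive _ _ X _]eq_fun do rewrite mul1r.
    exact.
  have h3 := is_derive_mulf h1
    (@is_deriveV R (fun y => 1 + (b N).[y]) u _ 1 (S1 _ u0) h2) erefl.
  apply: (is_derive_mulf (d1 x u) h3).
  rewrite /dpsi /GRing.scale /= /dS /c; move: (S1 _ u0) => ?; field.
  by [].
have [||xi /[!in_itv]/= /andP[xi0 xiv] E] := @MVT_segment R psi dpsi 0 v v0.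
- by move=> u /[!in_itv]/= /andP[u0 _]; apply: dpsiE; exact: ltW.
- apply: within_itv_continuous => u /andP[u0 _].
  exact: (is_derive_continuous (dpsiE _ u0)).
have psi0 : psi 0 = 1.
  rewrite /psi mulr0 expR0 mul1r (_ : (b N).[0] = 0) ?mulr0 ?addr0 ?invr1 ?mulr1 //.
  by rewrite horner_coef0 coef_poly.
(* The factor [c] makes the monotonicity independent of the sign of [x - 1]. *)
have cpsi : c * psi v <= c.
  have -> : psi v = 1 + dpsi xi * v by rewrite -psi0 -[v in RHS]subr0 -E addrC subrK.
  rewrite mulrDr mulr1 gerDl mulrA mulr_le0_ge0 //.
  have -> : c * dpsi xi = (c ^+ 2 * expR (- c * xi) / (1 + (b N).[xi]) ^+ 2) *
      (dS xi - (1 + (b N).[xi]) * (1 + x * (b N).[xi])) by rewrite /dpsi; ring.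
  apply: mulr_ge0_le0.
    by rewrite mulr_ge0 ?invr_ge0 ?sqr_ge0 // mulr_ge0 ?sqr_ge0 ?expR_ge0.
  have : 0 <= (ode_defect A x N).[xi].
    by apply: horner_ge0 => // i; case/andP: (ode_defect_bounds A_eulerian x_neq1 x_ge0 N i).
  by rewrite /ode_defect !hornerE /dS; lra.
have e0 := expR_gt0 (c * v).
have : c * (1 + x * (b N).[v]) <= c * (1 + (b N).[v]) * expR (c * v).
  have -> : c * (1 + x * (b N).[v]) = (c * psi v) * (expR (c * v) * (1 + (b N).[v])).
    rewrite /psi mulNr expRN; move: (S1 _ v0) => ?; field.
    by apply/andP; split => //; rewrite gt_eqF.
  rewrite [leRHS]mulrAC -[leRHS]mulrA ler_wpM2r //.
  by rewrite mulr_ge0 ?expR_ge0 // addr_ge0 // S0.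
move: w0; set e := expR (c * v); set S := (b N).[v] => w0 H.
have xe : x - e != 0 by apply: contraTneq w0 => ->; rewrite mul0r ltxx.
have -> : (e - 1) / (x - e) = (e - 1) / c / ((x - e) / c).
  by field; rewrite c_neq0.
rewrite ler_pdivlMr // -subr_ge0.
have -> : (e - 1) / c - S * ((x - e) / c) =
    (c * (1 + S) * e - c * (1 + x * S)) / c ^+ 2.
  by rewrite /c; field.
by rewrite divr_ge0 ?sqr_ge0 // subr_ge0.
Qed.

End EulerianBound.

Lemma divr_factS_muln (R : numFieldType) (y : R) k : y / k.+1`!%:R *+ k.+1 = y / k`!%:R.
Proof.
have m0 : k.+1%:R != 0 :> R by rewrite pnatr_eq0.
have f0 : k`!%:R != 0 :> R by rewrite pnatr_eq0 -lt0n fact_gt0.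
rewrite factS natrM -[LHS]mulr_natr.
move: (k.+1%:R) m0 (k`!%:R) f0 => m m0 f f0.
by field; rewrite f0 m0.
Qed.

(** * Convolution of truncated exponential series *)

Section PolyConvolution.
Variables (R : realType) (a E : nat -> R).

(* the i-th derivative of [sum_(1 <= n <= N) a_n u^n / n!] *)
Definition egf_deriv (N i : nat) : {poly R} :=
  \poly_(k < N.+1 - i) (a (k + i)%N / k`!%:R).

(* the i-th iterated integral of [sum_(n <= N) E_n u^n / n!] *)
Definition egf_primitive (N i : nat) : {poly R} :=
  \poly_(j < N.+1 + i) (if (i <= j)%N then E (j - i)%N / j`!%:R else 0).

Local Notation V := egf_deriv.
Local Notation W := egf_primitive.

Lemma deriv_egf_deriv N i : (V N i)^`() = V N i.+1.
Proof.
apply/polyP => k; rewrite coef_deriv !coef_poly.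
have -> : (k.+1 < N.+1 - i)%N = (k < N.+1 - i.+1)%N by lia.
by case: ifP => _; rewrite ?mul0rn // divr_factS_muln addSnnS.
Qed.

Lemma deriv_egf_primitive N i : (W N i.+1)^`() = W N i.
Proof.
apply/polyP => j; rewrite coef_deriv !coef_poly.
have -> : (j.+1 < N.+1 + i.+1)%N = (j < N.+1 + i)%N by lia.
rewrite ltnS subSS.
by do 2?[case: ifP => _]; rewrite ?mul0rn // divr_factS_muln.
Qed.

(** Repeated integration by parts: the derivative of [F] telescopes and stops because
    [egf_deriv N N.+1] is zero. At [y = s] the derivatives give the values [a i.+1], and at [y = 0]
    the primitives vanish. The scale [sg] is later [lambda] for bounds and [- lambda] for the
    solution. *)
Lemma poly_convolution N (sg s : R) : 0 <= s ->
  \int[lebesgue_measure]_(y in `[0, s])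
    (sg * ((V N 1).[sg * (s - y)] * (W N 0).[sg * y])) =
  (\sum_(i < N) a i.+1 *: W N i.+1).[sg * s].
Proof.
move=> s0.
pose F (y : R) : R := \sum_(i < N) (V N i.+1).[sg * (s - y)] * (W N i.+1).[sg * y].
have dV i (y : R) : is_derive y 1 (fun y => (V N i).[sg * (s - y)])
    (- (sg * (V N i.+1).[sg * (s - y)])).
  rewrite -deriv_egf_deriv.
  exact: (@is_derive_rev R (fun z => (V N i).[sg * z]) _ s y (is_derive_horner_scale _ _ _)).
have dW i (y : R) : is_derive y 1 (fun y => (W N i.+1).[sg * y])
    (sg * (W N i).[sg * y]).
  by rewrite -(deriv_egf_primitive N i); exact: is_derive_horner_scale.
have cV i : continuous (fun y => (V N i).[sg * (s - y)]).
  by move=> y; exact: (is_derive_continuous (dV i y)).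
have dF (y : R) : is_derive y 1 F (sg * ((V N 1).[sg * (s - y)] * (W N 0).[sg * y])).
  have -> : F = \sum_(i < N) (fun y => (V N i.+1).[sg * (s - y)] * (W N i.+1).[sg * y]).
    by apply/funext => z; rewrite fct_sumE.
  pose T i := sg * ((V N i.+1).[sg * (s - y)] * (W N i).[sg * y]).
  have -> : sg * ((V N 1).[sg * (s - y)] * (W N 0).[sg * y]) =
      \sum_(i < N) (T i - T i.+1).
    transitivity (- \sum_(i < N) (T i.+1 - T i)); last first.
      by rewrite -sumrN; apply: eq_bigr => i _; rewrite opprB.
    rewrite -(big_mkord xpredT (fun i => T i.+1 - T i)) telescope_sumr // opprB.
    rewrite [T N](_ : _ = 0) ?subr0 // /T (_ : V N N.+1 = 0).
      by rewrite horner0 mul0r mulr0.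
    by apply/polyP => k; rewrite coef_poly subnn coef0.
  apply: is_derive_sum => i.
  by apply: (is_derive_mulf (dV _ _) (dW _ _)); rewrite /T; ring.
have cF : continuous F by move=> y; exact: (is_derive_continuous (dF y)).
rewrite (Rintegral_primitive s0 _ (fun y _ => cF y) (fun y _ => dF y)); last first.
  move=> y _; apply: continuousM; first exact: cvg_cst.
  by apply: continuousM; [exact: cV | exact: horner_scale_continuous].
rewrite /F [X in _ - X]big1 => [|i _]; last first.
  by rewrite mulr0 [(W _ _).[_]]horner_coef0 coef_poly /= mulr0.
rewrite subr0 horner_sum; apply: eq_bigr => i _.
rewrite subrr mulr0 horner_coef0 coef_poly subn_gt0 ltnS ltn_ord fact0 divr1 hornerZ.
by rewrite add0n.
Qed.

Lemma coef_poly_convolution N n :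
  (\sum_(i < N) a i.+1 *: W N i.+1)`_n =
  \sum_(i < N) a i.+1 * (if (i < n < N + i.+2)%N then E (n - i.+1)%N / n`!%:R else 0).
Proof.
rewrite coef_sum; apply: eq_bigr => i _; rewrite coefZ coef_poly.
by congr (_ * _); rewrite [(i < n < _)%N]andbC addSnnS; case: ifP.
Qed.

End PolyConvolution.

Lemma coef_exp_ge0 (R : numDomainType) (p : {poly R}) k :
  (forall i, 0 <= p`_i) -> forall i, 0 <= (p ^+ k)`_i.
Proof.
move=> p0; elim: k => [|k IH] i; first by rewrite expr0 coef1.
by rewrite exprS coefM sumr_ge0 // => j _; rewrite mulr_ge0.
Qed.

(** * Uniform bounds for the renewal series *)

Section RenewalSeries.
Variables (R : realType) (A : nat -> {poly R}) (lambda mu D : R).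
Hypothesis A_eulerian : eulerian_polynomials A.
Hypotheses (lambda_gt0 : 0 < lambda) (mu_gt0 : 0 < mu) (mu_neq : mu != lambda).
Hypothesis D_ge0 : 0 <= D.

Local Notation G := (G_fun lambda mu).
Let x := mu / lambda.
Let a n := (A n).[x].
Let E := renewal_coef a D.
Let b N := eulerian_egf A x N.

Let x_ge0 : 0 <= x. Proof. by rewrite divr_ge0 ?ltW. Qed.
Let x_neq1 : x != 1.
Proof. by apply: contra mu_neq => /eqP x1; rewrite -[mu](divfK (lt0r_neq0 lambda_gt0)) -/x x1 mul1r. Qed.
Let a_ge0 n : 0 <= a n. Proof. exact: eulerian_value_ge0. Qed.
Let b_ge0 N i : 0 <= (b N)`_i. Proof. exact: eulerian_egf_ge0. Qed.

Definition renewal_egf (N : nat) : {poly R} := egf_primitive E N 0.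

Let e := renewal_egf.
Let C N := \sum_(i < N) a i.+1 *: egf_primitive E N i.+1.

Definition renewal_defect (N : nat) : {poly R} := D *: C N - e N + b N.

Let Z := renewal_defect.

Let E_ge0 n : 0 <= E n.
Proof.
apply: sumr_ge0 => k _; apply: mulr_ge0; first exact: exprn_ge0.
by apply: coef_exp_ge0 => i; rewrite coef_poly; do 2?[case: ifP => _].
Qed.

Let e_coef N i : (e N)`_i = if (i <= N)%N then E i / i`!%:R else 0.
Proof. by rewrite coef_poly addn0 ltnS subn0. Qed.

Let e_ge0 N i : 0 <= (e N)`_i.
Proof. by rewrite e_coef; case: ifP => // _; rewrite divr_ge0. Qed.

Let C_ge0 N i : 0 <= (C N)`_i.
Proof.
rewrite coef_poly_convolution; apply: sumr_ge0 => j _; apply: mulr_ge0 => //.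
by case: ifP => // _; rewrite divr_ge0.
Qed.

(** Up to degree N the truncation is invisible, and the coefficients satisfy [renewal_coefS] divided
    by a factorial. *)
Lemma renewal_defect_low N i : (i < N.+1)%N -> (Z N)`_i = 0.
Proof.
rewrite ltnS coefD coefB coefZ e_coef coef_poly_convolution coef_eulerian_egf.
case: i => [_|n nN] /=.
  rewrite big1 => [|i _]; last by rewrite mulr0.
  by rewrite /E renewal_coef0 mul0r mulr0 subr0 addr0.
rewrite nN /E renewal_coefS -/E big_ord_recl mul0r add0r.
pose T i := a i.+1 * (if (i < n.+1 < N + i.+2)%N then E (n.+1 - i.+1)%N / n.+1`!%:R else 0).
set S := (X in _ + D * X).
have -> : \sum_(i < N) a i.+1 * (if (i < n.+1 < N + i.+2)%N
    then E (n.+1 - i.+1)%N / n.+1`!%:R else 0) = S / n.+1`!%:R.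
  rewrite -(big_mkord xpredT T) (big_nat_vanish nN) => [|j nj]; last first.
    by rewrite /T ltnNge nj mulr0.
  rewrite big_mkord mulr_suml; apply: eq_bigr => i _; rewrite /T ltn_ord /=.
  by rewrite (_ : (n.+1 < N + i.+2)%N) ?mulrA // addnS ltnS (leq_trans nN) ?leq_addr.
rewrite -/(a n.+1); ring.
Qed.

(** Above degree N both truncated series have stopped, and only the convolution remains. *)
Lemma renewal_defect_bounds N i : 0 <= (Z N)`_i <= D * (C N)`_i.
Proof.
have DC : 0 <= D * (C N)`_i by rewrite mulr_ge0.
have [iN|Ni] := ltnP i N.+1; first by rewrite renewal_defect_low // lexx DC.
rewrite coefD coefB coefZ e_coef coef_eulerian_egf [(i <= N)%N]leqNgt Ni andbF.
by rewrite subr0 addr0 DC lexx.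
Qed.

Let b_deriv N : (b N)^`() = egf_deriv a N 1.
Proof.
apply/polyP => k; rewrite coef_deriv coef_eulerian_egf coef_poly /= subn1 /=.
by case: ifP => _; rewrite ?mul0rn // divr_factS_muln addn1.
Qed.

Lemma renewal_egf_volterra N (sg s : R) : 0 <= s ->
  (e N).[sg * s] = (b N).[sg * s] - (Z N).[sg * s] + D *
    \int[lebesgue_measure]_(y in `[0, s])
      (sg * ((b N)^`().[sg * (s - y)] * (e N).[sg * y])).
Proof.
move=> s0; rewrite b_deriv poly_convolution // /Z /renewal_defect !hornerE; ring.
Qed.

Section Bounds.
Variables (r K : R).
Hypotheses (r_gt0 : 0 < r) (bK : forall N, (b N).[lambda * r] <= K).

Let v_ge0 : 0 <= lambda * r. Proof. by rewrite mulr_ge0 ?ltW. Qed.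

Let M := (1 + K) * (1 + x * K).

Let K_ge0 : 0 <= K.
Proof. by apply: le_trans (bK 0); exact: horner_ge0. Qed.

Let rhs_bound N : ((1 + b N) * (1 + x *: b N)).[lambda * r] <= M.
Proof.
have bv0 : 0 <= (b N).[lambda * r] by exact: horner_ge0.
rewrite !hornerE; apply: ler_pM.
- exact: addr_ge0.
- by rewrite addr_ge0 // mulr_ge0.
- by rewrite lerD2l.
- by rewrite lerD2l ler_wpM2l.
Qed.

Lemma ode_defect_bound N : (ode_defect A x N).[lambda * r] <= M.
Proof.
apply: le_trans (rhs_bound N); apply: horner_coef_le => // i.
by case/andP: (ode_defect_bounds A_eulerian x_neq1 x_ge0 N i).
Qed.

(** The defect has nonnegative coefficients, so the derivative at [lambda * r] is at most the
    right-hand side of the differential equation, which [K] controls. *)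
Lemma eulerian_deriv_bound N (y : R) : `|y| <= lambda * r -> `|(b N)^`().[y]| <= M.
Proof.
move=> yv; apply: (@le_trans _ _ ((b N)^`().[lambda * r])).
  by apply: norm_horner_le => // i; rewrite coef_deriv mulrn_wge0.
have -> : (b N)^`() = (1 + b N) * (1 + x *: b N) - ode_defect A x N.
  by rewrite /ode_defect opprB addrC subrK.
rewrite hornerD hornerN; apply: le_trans (rhs_bound N); rewrite gerBl.
apply: horner_ge0 => // i.
by case/andP: (ode_defect_bounds A_eulerian x_neq1 x_ge0 N i).
Qed.

Lemma renewal_defect_bound : exists K', forall N, (Z N).[lambda * r] <= K'.
Proof.
have M0 : 0 <= M by apply: mulr_ge0; apply: addr_ge0 => //; exact: mulr_ge0.
have scale (s : R) : 0 <= s <= r -> `|lambda * s| <= lambda * r.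
  move=> /andP[s0 sr]; rewrite ger0_norm ?mulr_ge0 ?(ltW lambda_gt0) //.
  by rewrite ler_wpM2l // ltW.
have conv N (s : R) : 0 <= s <= r ->
    \int[lebesgue_measure]_(y in `[0, s])
      (lambda * ((b N)^`().[lambda * (s - y)] * (e N).[lambda * y])) <=
    lambda * M * \int[lebesgue_measure]_(y in `[0, s]) `|(e N).[lambda * y]|.
  move=> /andP[s0 sr].
  have cn (y : R) : {for y, continuous (fun z => `|(e N).[lambda * z]|)}.
    by apply: continuous_norm_fun; exact: horner_scale_continuous.
  rewrite -itv_RintegralZ; last by move=> y _; exact: cn.
  apply: le_itv_Rintegral => y ys.
  - apply: continuousM; first exact: cvg_cst.
    apply: continuousM; last exact: horner_scale_continuous.
    exact: (is_derive_continuous (is_derive_rev (is_derive_horner_scale _ lambda (s - y)))).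
  - by apply: continuousM; [exact: cvg_cst | exact: cn].
  rewrite -mulrA ler_wpM2l ?(ltW lambda_gt0) //.
  apply: (le_trans (ler_norm _)); rewrite normrM ler_wpM2r //.
  by apply: eulerian_deriv_bound; apply: scale; lra.
pose K2 := 2 * K * expR (2 * (D * (lambda * M)) * r).
have eK2 N (s : R) : 0 <= s <= r -> `|(e N).[lambda * s]| <= K2.
  apply: (@gronwall R (fun y => (e N).[lambda * y])) => //.
  - by rewrite mulr_ge0 // mulr_ge0 // ltW.
  - exact: ltW.
  - by move=> y _; exact: horner_scale_continuous.
  move=> y /andP[y0 yr].
  rewrite ger0_norm; last by apply: horner_ge0 => //; rewrite mulr_ge0 // ltW.
  rewrite renewal_egf_volterra //.
  have Zy : 0 <= (Z N).[lambda * y].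
    apply: horner_ge0; last by rewrite mulr_ge0 // ltW.
    by move=> i; case/andP: (renewal_defect_bounds N i).
  have by' : (b N).[lambda * y] <= K.
    apply: le_trans (bK N); apply: (le_trans (ler_norm _)).
    by apply: norm_horner_le => //; apply: scale; rewrite y0.
  rewrite -mulrA; apply: lerD; first lra.
  by rewrite ler_wpM2l // conv // y0.
exists (D * (lambda * M * (K2 * r))) => N.
apply: (@le_trans _ _ ((D *: C N).[lambda * r])).
  apply: horner_coef_le => // i; rewrite coefZ.
  by case/andP: (renewal_defect_bounds N i).
rewrite hornerZ ler_wpM2l // -poly_convolution -?b_deriv; last exact: ltW.
apply: (le_trans (conv N r _)); first by rewrite lexx ltW.
have lM : 0 <= lambda * M by rewrite mulr_ge0 // ltW.
apply: (ler_wpM2l lM); rewrite -(itv_Rintegral_cst K2 (ltW r_gt0)).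
apply: le_itv_Rintegral => y yr.
- by apply: continuous_norm_fun; exact: horner_scale_continuous.
- exact: cvg_cst.
- exact: eK2.
Qed.

End Bounds.
End RenewalSeries.

(** * Geometric convergence at negative arguments *)

Section RenewalConvergence.
Variables (R : realType) (A : nat -> {poly R}) (lambda mu D : R).
Hypothesis A_eulerian : eulerian_polynomials A.
Hypotheses (lambda_gt0 : 0 < lambda) (mu_gt0 : 0 < mu) (mu_neq : mu != lambda).
Hypothesis D_ge0 : 0 <= D.

Local Notation G := (G_fun lambda mu).
Local Notation x := (mu / lambda).
Local Notation b := (eulerian_egf A x).
Local Notation e := (renewal_egf A lambda mu D).
Local Notation Z := (renewal_defect A lambda mu D).
Let ker (s : R) := (1 - G s) * (lambda - mu * G s).

Let x_ge0 : 0 <= x. Proof. by rewrite divr_ge0 ?ltW. Qed.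
Let x_neq1 : x != 1.
Proof.
apply: contra mu_neq => /eqP x1.
by rewrite -[mu](divfK (lt0r_neq0 lambda_gt0)) x1 mul1r.
Qed.
Let b_ge0 N i : 0 <= (b N)`_i. Proof. exact: eulerian_egf_ge0. Qed.

Let G_continuous (s : R) : 0 <= s -> {for s, continuous G}.
Proof. by move=> /(is_derive_G_fun lambda_gt0 mu_neq); exact: is_derive_continuous. Qed.

Let ker_continuous (s : R) : 0 <= s -> {for s, continuous ker}.
Proof.
move=> s0; apply: continuousM; apply: continuousB; try exact: cvg_cst.
  exact: G_continuous.
by apply: continuousM; [exact: cvg_cst | exact: G_continuous].
Qed.

Let rev_continuous (F : R -> R) (s y : R) :
  {for s - y, continuous F} -> {for y, continuous (fun z => F (s - z))}.
Proof.
move=> cF; apply: (@continuous_comp _ _ _ (fun z => s - z) F y) => //.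
by apply: continuousB; [exact: cvg_cst | exact: cvg_id].
Qed.

Variables (t r K : R).
Hypotheses (t_ge0 : 0 <= t) (t_lt_r : t < r).
Hypothesis bK : forall N, (b N).[lambda * r] <= K.

Let r_gt0 : 0 < r := le_lt_trans t_ge0 t_lt_r.
Let th := t / r.
Let M := (1 + K) * (1 + x * K).

Let th01 : 0 <= th <= 1.
Proof. by rewrite divr_ge0 ?(ltW r_gt0) //= ler_pdivrMr // mul1r ltW. Qed.

Let v_ge0 : 0 <= lambda * r. Proof. by rewrite mulr_ge0 ?ltW. Qed.

Let K_ge0 : 0 <= K.
Proof. by apply: le_trans (bK 0); exact: horner_ge0. Qed.

Let M_ge0 : 0 <= M.
Proof. by apply: mulr_ge0; apply: addr_ge0 => //; exact: mulr_ge0. Qed.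

Let arg_th (s : R) : 0 <= s <= t -> `|- lambda * s| <= th * (lambda * r).
Proof.
move=> /andP[s0 st]; rewrite mulNr normrN ger0_norm; last by rewrite mulr_ge0 // ltW.
by rewrite /th mulrCA divfK ?gt_eqF // ler_wpM2l // ltW.
Qed.

Let arg_r (s : R) : 0 <= s <= t -> `|- lambda * s| <= lambda * r.
Proof.
move=> st; apply: (le_trans (arg_th st)).
by rewrite -[leRHS]mul1r ler_wpM2r //; case/andP: th01.
Qed.

Let thN_ge0 N : 0 <= th ^+ N.
Proof. by case/andP: th01 => th0 _; exact: exprn_ge0. Qed.

Lemma eulerian_egf_rate : exists C, 0 <= C /\ forall N (s : R), 0 <= s <= t ->
  `|- G s - (b N).[- lambda * s]| <= C * th ^+ N /\
  `|ker s - lambda * (b N)^`().[- lambda * s]| <= C * th ^+ N.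
Proof.
(* A Lipschitz constant for the Riccati equation: [1 + K] bounds the sum of the two functions
   compared. *)
pose L := lambda * (1 + x + x * (1 + K)).
have L0 : 0 <= L.
  apply: mulr_ge0; first exact: ltW.
  by apply: addr_ge0; [exact: addr_ge0 | apply: mulr_ge0 => //; exact: addr_ge0].
pose C1 := 2 * (lambda * M * t) * expR (2 * L * t).
have lM : 0 <= lambda * M by apply: mulr_ge0 => //; exact: ltW.
have C10 : 0 <= C1 by rewrite mulr_ge0 ?expR_ge0 // mulr_ge0 // mulr_ge0.
exists (C1 + (L * C1 + lambda * M)); split.
  by rewrite addr_ge0 // addr_ge0 // mulr_ge0.
move=> N.
pose z (s : R) : R := - G s - (b N).[- lambda * s].
pose dz (s : R) : R := - (ker s - lambda * (b N)^`().[- lambda * s]).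
have dzE (s : R) : 0 <= s -> is_derive s 1 z (dz s).
  move=> s0.
  have h1 := is_derive_mull (-1) (is_derive_G_fun lambda_gt0 mu_neq s0).
  have h2 := is_derive_mull (-1) (is_derive_horner_scale (b N) (- lambda) s).
  have -> : z = (fun y => (-1) * G y + (-1) * (b N).[- lambda * y]).
    by apply/funext => y; rewrite /z !mulN1r.
  by apply: (is_derive_addf h1 h2); rewrite /dz /ker; ring.
have cz (s : R) : 0 <= s -> {for s, continuous z}.
  by move=> /dzE; exact: is_derive_continuous.
have cdz (s : R) : 0 <= s -> {for s, continuous dz}.
  move=> s0; apply: continuousN; apply: continuousB; first exact: ker_continuous.
  by apply: continuousM; [exact: cvg_cst | exact: horner_scale_continuous].
have dz_le (s : R) : 0 <= s <= t -> `|dz s| <= L * `|z s| + lambda * M * th ^+ N.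
  move=> st; have [s0 _] := andP st.
  have /andP[G0 G1] := G_fun_bounds lambda_gt0 mu_neq s0.
  have bs : `|(b N).[- lambda * s]| <= K.
    by apply: le_trans (bK N); apply: norm_horner_le => //; exact: arg_r.
  have defect_s : `|(ode_defect A x N).[- lambda * s]| <= M * th ^+ N.
    rewrite [leRHS]mulrC; apply: (@le_trans _ _ (th ^+ N * (ode_defect A x N).[lambda * r])).
      apply: norm_horner_low => //; last exact: arg_th.
      - by move=> i; case/andP: (ode_defect_bounds A_eulerian x_neq1 x_ge0 N i).
      - by move=> i; exact: ode_defect_low.
    by rewrite ler_wpM2l // ode_defect_bound.
  (* One function solves the Riccati equation and the other solves it up to [ode_defect]; the
     difference of the quadratic right-hand sides is divisible by [z s]. *)
  have -> : dz s = - (lambda * (1 + x + x * (- G s + (b N).[- lambda * s])) * z s)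
      - lambda * (ode_defect A x N).[- lambda * s].
    rewrite /dz /z /ker /ode_defect !hornerE /=.
    by field; exact: lt0r_neq0.
  apply: (le_trans (ler_normB _ _)); rewrite normrN; apply: lerD.
    rewrite normrM ler_wpM2r // normrM (gtr0_norm lambda_gt0) ler_wpM2l ?(ltW lambda_gt0) //.
    apply: (le_trans (ler_normD _ _)); apply: lerD.
      by rewrite ger0_norm // addr_ge0.
    rewrite normrM (ger0_norm x_ge0) ler_wpM2l //.
    apply: (le_trans (ler_normD _ _)); apply: lerD => //.
    by rewrite normrN ger0_norm // ltW.
  by rewrite normrM (gtr0_norm lambda_gt0) -mulrA ler_wpM2l // ltW.
have z0 : z 0 = 0.
  rewrite /z mulr0 G_fun0 // oppr0 sub0r horner_coef0 coef_poly /=.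
  by rewrite oppr0.
have z_le (s : R) : 0 <= s <= t -> `|z s| <= C1 * th ^+ N.
  have -> : C1 * th ^+ N = 2 * (lambda * M * t * th ^+ N) * expR (2 * L * t).
    by rewrite /C1; ring.
  apply: gronwall => //.
  - by rewrite mulr_ge0 // mulr_ge0.
  - by move=> y /andP[y0 _]; exact: cz.
  move=> y /andP[y0 yt].
  have cnz (w : R) : 0 <= w <= y -> {for w, continuous (fun u => `|z u|)}.
    by move=> /andP[w0 _]; apply: continuous_norm_fun; exact: cz.
  have -> : z y = \int[lebesgue_measure]_(w in `[0, y]) dz w.
    have H1 (w : R) : 0 <= w <= y -> {for w, continuous dz}.
      by move=> /andP[w0 _]; exact: cdz.
    have H2 (w : R) : 0 <= w <= y -> {for w, continuous z}.
      by move=> /andP[w0 _]; exact: cz.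
    have H3 (w : R) : 0 < w < y -> is_derive w 1 z (dz w).
      by move=> /andP[w0 _]; apply: dzE; exact: ltW.
    by rewrite (Rintegral_primitive y0 H1 H2 H3) z0 subr0.
  apply: (@le_trans _ _ (\int[lebesgue_measure]_(w in `[0, y])
      (lambda * M * th ^+ N + L * `|z w|))).
    apply: le_norm_itv_Rintegral => w wy.
    - by case/andP: wy => w0 _; exact: cdz.
    - apply: continuousD; first exact: cvg_cst.
      by apply: continuousM; [exact: cvg_cst | exact: cnz].
    - rewrite addrC; apply: dz_le; case/andP: wy => -> /=.
      by move/le_trans; apply.
  rewrite itv_RintegralD; last 2 first.
  - by move=> w _; exact: cvg_cst.
  - by move=> w wy; apply: continuousM; [exact: cvg_cst | exact: cnz].
  rewrite itv_Rintegral_cst // itv_RintegralZ // lerD2r [leRHS]mulrAC.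
  by rewrite ler_wpM2l // mulr_ge0.
move=> s st; split.
  by apply: (le_trans (z_le _ st)); rewrite ler_wpM2r // lerDl addr_ge0 // mulr_ge0.
rewrite -normrN; apply: (le_trans (dz_le _ st)).
apply: (@le_trans _ _ (L * (C1 * th ^+ N) + lambda * M * th ^+ N)).
  by rewrite lerD2r ler_wpM2l // z_le.
by rewrite mulrA -mulrDl ler_wpM2r // lerDr.
Qed.

Variable f : R -> R.
Hypothesis f_continuous : continuous f.
Hypothesis f01 : forall s, 0 <= f s <= 1.
Hypothesis f_volterra : forall s : R, 0 <= s -> f s = 1 - G s - D *
  \int[lebesgue_measure]_(y in `[0, s])
    ((1 - G (s - y)) * (lambda - mu * G (s - y)) * f y).

Let phi (s : R) : R := (f s - 1) / (D + 1).

Let d_gt0 : 0 < D + 1. Proof. by rewrite ltr_wpDl. Qed.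

Let phi_continuous : continuous phi.
Proof.
move=> s; rewrite /phi; apply: cvgM; last exact: cvg_cst.
by apply: cvgB; [exact: f_continuous | exact: cvg_cst].
Qed.

Let phi_le1 s : `|phi s| <= 1.
Proof.
have /andP[f0 f1] := f01 s.
rewrite normrM normfV (gtr0_norm d_gt0) ler_pdivrMr // mul1r.
by rewrite ler_norml; apply/andP; split; move: D_ge0; lra.
Qed.

Let kerrev_continuous (s y : R) : 0 <= y <= s ->
  {for y, continuous (fun y => ker (s - y))}.
Proof.
by move=> /andP[_ ys]; apply: rev_continuous; apply: ker_continuous; rewrite subr_ge0.
Qed.

(** The kernel integrates to [G], so subtracting 1 from [f] and dividing by [D + 1] changes the
    inhomogeneous term from [1 - G] into [- G], the limit of the Eulerian truncations. *)
Let phi_volterra (s : R) : 0 <= s -> phi s = - G s - D *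
  \int[lebesgue_measure]_(y in `[0, s]) (ker (s - y) * phi y).
Proof.
move=> s0.
have kerG : \int[lebesgue_measure]_(y in `[0, s]) ker (s - y) = G s.
  have dG (y : R) : 0 <= y <= s -> is_derive y 1 (fun y => - 1 * G (s - y)) (ker (s - y)).
    move=> /andP[_ ys].
    have sy : 0 <= s - y by rewrite subr_ge0.
    have := is_derive_mull (-1) (is_derive_rev (is_derive_G_fun lambda_gt0 mu_neq sy)).
    by rewrite mulN1r opprK.
  have H2 (y : R) : 0 <= y <= s -> {for y, continuous (fun y => - 1 * G (s - y))}.
    by move=> /dG; exact: is_derive_continuous.
  have H3 (y : R) : 0 < y < s ->
      is_derive y 1 (fun y => - 1 * G (s - y)) (ker (s - y)).
    by move=> /andP[y0 ys]; apply: dG; rewrite !ltW.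
  rewrite (Rintegral_primitive s0 (@kerrev_continuous s) H2 H3).
  by rewrite subrr subr0 G_fun0 //; ring.
have fE y : f y = 1 + (D + 1) * phi y.
  by rewrite /phi mulrC divfK ?gt_eqF // addrC subrK.
rewrite {1}/phi f_volterra //.
have -> : \int[lebesgue_measure]_(y in `[0, s])
      ((1 - G (s - y)) * (lambda - mu * G (s - y)) * f y) =
    \int[lebesgue_measure]_(y in `[0, s])
      (ker (s - y) + (D + 1) * (ker (s - y) * phi y)).
  by apply: eq_Rintegral => y _; rewrite fE /ker; ring.
have ckphi (y : R) : 0 <= y <= s -> {for y, continuous (fun y => ker (s - y) * phi y)}.
  move=> ys; apply: continuousM; last exact: phi_continuous.
  exact: kerrev_continuous.
rewrite itv_RintegralD; last 2 first.
- by move=> y; exact: kerrev_continuous.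
- by move=> y ys; apply: continuousM; [exact: cvg_cst | exact: ckphi].
rewrite itv_RintegralZ // kerG; field.
exact: lt0r_neq0.
Qed.

Lemma renewal_egf_rate : exists C, forall N,
  `|(f t - 1) / (D + 1) - (e N).[- lambda * t]| <= C * th ^+ N.
Proof.
have [C [C0 bC]] := eulerian_egf_rate.
have [K3 ZK3] := renewal_defect_bound A_eulerian lambda_gt0 mu_gt0 mu_neq D_ge0 r_gt0 bK.
have Zb N i : 0 <= (Z N)`_i.
  by case/andP: (renewal_defect_bounds A_eulerian lambda_gt0 mu_gt0 mu_neq D_ge0 N i).
have K30 : 0 <= K3 by apply: le_trans (ZK3 0); exact: horner_ge0.
have lM : 0 <= lambda * M by apply: mulr_ge0 => //; exact: ltW.
(* The three sources of error: the Eulerian truncation, the renewal defect, and the truncated kernel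
   integrated against [phi]. *)
pose c0 := C + K3 + D * (C * t).
have c00 : 0 <= c0 by rewrite !addr_ge0 ?mulr_ge0.
exists (2 * c0 * expR (2 * (D * (lambda * M)) * t)) => N.
pose eta (s : R) : R := phi s - (e N).[- lambda * s].
have ceta : continuous eta.
  by move=> s; apply: continuousB; [exact: phi_continuous | exact: horner_scale_continuous].
have cneta (s : R) : {for s, continuous (fun y => `|eta y|)}.
  by apply: continuous_norm_fun; exact: ceta.
rewrite -/(eta t).
have -> : 2 * c0 * expR (2 * (D * (lambda * M)) * t) * th ^+ N =
    2 * (c0 * th ^+ N) * expR (2 * (D * (lambda * M)) * t) by ring.
apply: (@gronwall R eta); last by rewrite t_ge0 lexx.
- exact: mulr_ge0.
- exact: mulr_ge0.
- exact: t_ge0.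
- by move=> s _; exact: ceta.
move=> s /andP[s0 st].
(* The difference of the two convolutions, split into the kernel error acting on [phi] and the
   truncated kernel acting on [eta]; only the latter feeds Gronwall's inequality. *)
pose h (y : R) : R := (ker (s - y) - lambda * (b N)^`().[- lambda * (s - y)]) * phi y
  + lambda * (b N)^`().[- lambda * (s - y)] * eta y.
have cb (y : R) : {for y, continuous (fun y => (b N)^`().[- lambda * (s - y)])}.
  by apply: (@rev_continuous (fun w => (b N)^`().[- lambda * w]));
    exact: horner_scale_continuous.
have ckphi (y : R) : 0 <= y <= s -> {for y, continuous (fun y => ker (s - y) * phi y)}.
  move=> ys; apply: continuousM; last exact: phi_continuous.
  exact: kerrev_continuous.
have cbe (y : R) : {for y, continuous
    (fun y => - lambda * ((b N)^`().[- lambda * (s - y)] * (e N).[- lambda * y]))}.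
  apply: continuousM; first exact: cvg_cst.
  by apply: continuousM; [exact: cb | exact: horner_scale_continuous].
have etaE : eta s = (- G s - (b N).[- lambda * s]) + (Z N).[- lambda * s]
    - D * \int[lebesgue_measure]_(y in `[0, s]) h y.
  have -> : \int[lebesgue_measure]_(y in `[0, s]) h y =
      \int[lebesgue_measure]_(y in `[0, s]) (ker (s - y) * phi y) +
      \int[lebesgue_measure]_(y in `[0, s])
        (- lambda * ((b N)^`().[- lambda * (s - y)] * (e N).[- lambda * y])).
    rewrite -itv_RintegralD //; apply: eq_Rintegral => y _.
    by rewrite /h /eta; ring.
  by rewrite {1}/eta phi_volterra // renewal_egf_volterra //; ring.
have h_le (y : R) : 0 <= y <= s -> `|h y| <= C * th ^+ N + lambda * M * `|eta y|.
  move=> /andP[y0 ys].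
  have sy : 0 <= s - y <= t by rewrite subr_ge0 ys /=; lra.
  have [_ kb] := bC N _ sy.
  apply: (le_trans (ler_normD _ _)); apply: lerD.
    by rewrite normrM -[leRHS]mulr1 ler_pM.
  rewrite normrM ler_wpM2r // normrM (gtr0_norm lambda_gt0) ler_wpM2l ?(ltW lambda_gt0) //.
  by apply: (eulerian_deriv_bound A_eulerian lambda_gt0 mu_gt0 mu_neq r_gt0 bK); exact: arg_r.
have ch (y : R) : 0 <= y <= s -> {for y, continuous h}.
  move=> ys; apply: continuousD; apply: continuousM; last exact: ceta.
  - apply: continuousB; first exact: kerrev_continuous.
    by apply: continuousM; [exact: cvg_cst | exact: cb].
  - exact: phi_continuous.
  - by apply: continuousM; [exact: cvg_cst | exact: cb].
have cmaj (y : R) : {for y, continuous (fun y => lambda * M * `|eta y|)}.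
  by apply: continuousM; [exact: cvg_cst | exact: cneta].
have int_le : `|\int[lebesgue_measure]_(y in `[0, s]) h y| <=
    C * t * th ^+ N + lambda * M * \int[lebesgue_measure]_(y in `[0, s]) `|eta y|.
  apply: (@le_trans _ _ (\int[lebesgue_measure]_(y in `[0, s])
      (C * th ^+ N + lambda * M * `|eta y|))).
    apply: le_norm_itv_Rintegral => // y _.
    by apply: continuousD; [exact: cvg_cst | exact: cmaj].
  rewrite itv_RintegralD; last 2 first.
  - by move=> y _; exact: cvg_cst.
  - by move=> y _; exact: cmaj.
  rewrite itv_Rintegral_cst // itv_RintegralZ // lerD2r [leRHS]mulrAC.
  by rewrite ler_wpM2l // mulr_ge0.
have Zs : `|(Z N).[- lambda * s]| <= K3 * th ^+ N.
  rewrite [leRHS]mulrC; apply: (@le_trans _ _ (th ^+ N * (Z N).[lambda * r])).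
    apply: norm_horner_low => //; last by apply: arg_th; rewrite s0.
    by move=> i iN; apply: renewal_defect_low; exact: leqW.
  by rewrite ler_wpM2l.
have [bs _] := bC N s (introT andP (conj s0 st)).
rewrite etaE; apply: (le_trans (ler_normB _ _)).
apply: (@le_trans _ _ (C * th ^+ N + K3 * th ^+ N +
  D * (C * t * th ^+ N + lambda * M * \int[lebesgue_measure]_(y in `[0, s]) `|eta y|))).
  apply: lerD.
    by apply: (le_trans (ler_normD _ _)); exact: lerD.
  by rewrite normrM (ger0_norm D_ge0) ler_wpM2l.
by rewrite le_eqVlt; apply/orP; left; apply/eqP; rewrite /c0; ring.
Qed.

End RenewalConvergence.

Lemma cvg_geometric_rate (R : realType) (u : R^nat) (l C z : R) : 0 <= z < 1 ->
  (forall n, `|l - u n| <= C * z ^+ n) -> u n @[n --> \oo] --> l.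
Proof.
move=> /andP[z0 z1] uC; apply/cvgrPdist_le => eps eps0.
have /cvgr0Pnorm_le /(_ eps eps0) : C * z ^+ n @[n --> \oo] --> 0.
  by apply: cvg_geometric; rewrite ger0_norm.
apply: filterS => n; apply: le_trans; apply: (le_trans (uC n)); exact: ler_norm.
Qed.

(** * Identification of the sum of the series *)

Section Assembly.
Variables (R : realType) (d : nat) (lambda mu : R) (A : nat -> {poly R}).
Hypothesis A_eulerian : eulerian_polynomials A.
Hypotheses (d_gt0 : (0 < d)%N).
Hypotheses (lambda_gt0 : 0 < lambda) (mu_gt0 : 0 < mu) (mu_neq : mu != lambda).

Local Notation x := (mu / lambda).

(** The midpoint between [t] and the horizon leaves room for the ratio t/r below 1. The positivity
    condition says that [r] precedes the blow-up time, for either sign of [x - 1]. *)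
Lemma horizon_radius (t : R) : 0 < t < horizon lambda mu ->
  exists2 r, t < r & 0 < (x - expR ((x - 1) * (lambda * r))) / (x - 1).
Proof.
move=> /andP[t0 th]; exists ((t + horizon lambda mu) / 2); first lra.
set r := _ / 2; have rh : r < horizon lambda mu by rewrite /r; lra.
have x0 : 0 < x by rewrite divr_gt0.
have -> : (x - 1) * (lambda * r) = (mu - lambda) * r.
  by field; exact: lt0r_neq0.
move: rh; rewrite /horizon.
have [lt|lt|/esym/eqP] := ltgtP lambda mu; last by rewrite (negPf mu_neq).
  rewrite ltr_pdivlMr ?subr_gt0 // [r * _]mulrC => rh.
  apply: divr_gt0; last by rewrite subr_gt0 ltr_pdivlMr // mul1r.
  by rewrite subr_gt0 -[ltRHS](lnK x0) ltr_expR.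
rewrite ltr_ndivlMr ?subr_lt0 // [r * _]mulrC => rh.
rewrite -mulrNN -invrN !opprB; apply: divr_gt0.
  by rewrite subr_gt0 -[ltLHS](lnK x0) ltr_expR.
by rewrite subr_gt0 ltr_pdivrMr // mul1r.
Qed.

Lemma horner_egf (c : nat -> R) (N : nat) (u : R) :
  (\poly_(i < N.+1) (c i / i`!%:R)).[u] = \sum_(0 <= n < N.+1) u ^+ n / n`!%:R * c n.
Proof.
by rewrite horner_poly big_mkord; apply: eq_bigr => i _; ring.
Qed.

Let D : R := d%:R - 1.
Let a n := (A n).[x].

Let D_ge0 : 0 <= D. Proof. by rewrite subr_ge0 ler1n. Qed.

Let D_eq0 : (D == 0) = (d == 1%N).
Proof. by rewrite subr_eq0 -(eqr_nat R). Qed.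

(* the sum over n >= 2 of D^(n-1) u^n / n!, where u = - lambda t *)
Let tail (t : R) : R := if d == 1%N then 0 else
  D^-1 * (expR (- (lambda * t * D)) - 1 + lambda * t * D).

Let tail_term (u : R) (n : nat) : R := u ^+ n / n`!%:R * (if (n < 2)%N then 0 else D ^+ n.-1).

Let tail_cvg (t : R) :
  \sum_(0 <= n < N.+3) tail_term (- (lambda * t)) n @[N --> \oo] --> tail t.
Proof.
have tail_sum N : \sum_(0 <= n < N.+3) tail_term (- (lambda * t)) n =
    \sum_(2 <= n < N.+3) (- (lambda * t)) ^+ n / n`!%:R * D ^+ n.-1.
  rewrite big_ltn // big_ltn // /tail_term /= !mulr0 !add0r.
  rewrite big_nat_cond [RHS]big_nat_cond; apply: eq_bigr => n /andP[/andP[n2 _] _].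
  by rewrite ltnNge n2.
(* For [D = 0] every term vanishes, since n - 1 is positive for n at least 2; this is the limiting
   value read for d = 1. *)
rewrite /tail -D_eq0; case: (eqVneq D 0) => [D0|D0].
  have -> : (fun N => \sum_(0 <= n < N.+3) tail_term (- (lambda * t)) n) = (fun=> 0).
    apply/funext => N; rewrite tail_sum big_nat_cond big1 // => n /andP[/andP[n2 _] _].
    by rewrite D0 expr0n; case: n n2 => [|[|n]] //= _; rewrite mulr0.
  exact: cvg_cst.
have expE N : D * \sum_(0 <= n < N.+3) tail_term (- (lambda * t)) n =
    series (exp_coeff (- (lambda * t * D))) N.+3 - 1 + lambda * t * D.
  rewrite tail_sum /series /= [in RHS]big_ltn // [X in _ = _ + X - _ + _]big_ltn //.
  rewrite /exp_coeff /= fact0 expr0 divr1 (_ : 1`! = 1%N) // expr1 divr1 mulr_sumr.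
  rewrite [RHS](_ : _ = \sum_(2 <= n < N.+3) (- (lambda * t * D)) ^+ n / n`!%:R); last by ring.
  apply: eq_big_nat => -[|[|n]] // _.
  by rewrite -[- (_ * D)]mulNr exprMn [D ^+ n.+2]exprS /=; ring.
have -> : (fun N => \sum_(0 <= n < N.+3) tail_term (- (lambda * t)) n) =
    (fun N => D^-1 * (series (exp_coeff (- (lambda * t * D))) N.+3 - 1 + lambda * t * D)).
  by apply/funext => N; rewrite -expE mulKf.
apply: cvgM; first exact: cvg_cst.
apply: cvgD; last exact: cvg_cst.
apply: cvgB; last exact: cvg_cst.
have := is_cvg_series_exp_coeff (- (lambda * t * D)).
by rewrite /expR -3!cvg_shiftS.
Qed.

Let E := renewal_coef a D.

Lemma solution_termE (t : R) n : (2 < n)%N ->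
  solution_term d lambda mu A t n =
  (- (lambda * t)) ^+ n / n`!%:R * (E n - a n - D ^+ n.-1).
Proof.
by move=> n2; rewrite /solution_term (renewal_coef_eulerian _ A_eulerian).
Qed.

Let egf_horner N (u : R) : (eulerian_egf A x N.+2).[u] =
  \sum_(0 <= n < N.+3) u ^+ n / n`!%:R * (if n == 0%N then 0 else a n).
Proof.
rewrite -horner_egf; congr horner; apply/polyP => i; rewrite !coef_poly.
by case: ifP => // _; case: eqP => // _; rewrite mul0r.
Qed.

Let renewal_horner N (u : R) : (renewal_egf A lambda mu D N.+2).[u] =
  \sum_(0 <= n < N.+3) u ^+ n / n`!%:R * E n.
Proof.
rewrite -horner_egf; congr horner; apply/polyP => i; rewrite !coef_poly addn0.
by case: ifP => // _; rewrite subn0.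
Qed.

(** The sum may start at n = 3 because the terms of degree 0, 1 and 2 cancel: the renewal
    coefficients there are 0, [a 1] and [a 2 + D]. *)
Let partial_sumE (t : R) N : solution_partial_sum d lambda mu A t N.+3 =
  (renewal_egf A lambda mu D N.+2).[- lambda * t]
  - (eulerian_egf A x N.+2).[- lambda * t]
  - \sum_(0 <= n < N.+3) tail_term (- (lambda * t)) n.
Proof.
rewrite egf_horner renewal_horner mulNr -!sumrB.
rewrite [RHS](eq_bigr (fun n => (- (lambda * t)) ^+ n / n`!%:R *
  (E n - (if n == 0%N then 0 else a n) - (if (n < 2)%N then 0 else D ^+ n.-1)))); last first.
  by move=> n _; rewrite /tail_term; ring.
have a1 : a 1%N = 1 by exact: eulerian_value1.
have E0 : E 0%N = 0 by exact: renewal_coef0.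
have E1 : E 1%N = 1.
  by rewrite /E renewal_coefS !big_ord_recl big_ord0 /= renewal_coef0 a1; ring.
have E2 : E 2 = a 2 + D.
  rewrite /E renewal_coefS !big_ord_recl big_ord0 /= /bump /= subn1 subnn /=.
  by rewrite -/E E1 E0 a1; ring.
rewrite [RHS]big_ltn // big_ltn // big_ltn //= E0 E1 a1 E2.
rewrite !subr0 !subrr !mulr0 !add0r expr1 [a 2 + D]addrC addrK subrr mulr0 add0r.
rewrite /solution_partial_sum; apply: eq_big_nat => n /andP[n3 _].
by rewrite solution_termE // ltnNge ltnW //; case: n n3.
Qed.

Lemma volterra_series (f : R -> R) (t : R) :
  continuous f -> (forall s, 0 <= f s <= 1) ->
  (forall s : R, 0 <= s -> f s = 1 - G_fun lambda mu s - (d%:R - 1) *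
    \int[lebesgue_measure]_(y in `[0, s])
      ((1 - G_fun lambda mu (s - y)) * (lambda - mu * G_fun lambda mu (s - y)) * f y)) ->
  0 < t < horizon lambda mu ->
  cvgn (solution_partial_sum d lambda mu A t) /\ f t = series_solution d lambda mu A t.
Proof.
move=> fC f01 fV tH; have [r tr w0] := horizon_radius tH.
have /andP[t_gt0 _] := tH; have t0 := ltW t_gt0.
have x_ge0 : 0 <= x by rewrite divr_ge0 ?ltW.
have x_neq1 : x != 1.
  apply: contra mu_neq => /eqP x1.
  by rewrite -[mu](divfK (lt0r_neq0 lambda_gt0)) x1 mul1r.
have r0 : 0 < r := lt_trans t_gt0 tr.
have v0 : 0 <= lambda * r by rewrite mulr_ge0 ?ltW.
have bK N := eulerian_egf_bound A_eulerian x_neq1 x_ge0 N v0 w0.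
have th01 : 0 <= t / r < 1.
  by rewrite divr_ge0 ?(ltW r0) //= ltr_pdivrMr // mul1r.
have [C [_ bC]] := eulerian_egf_rate A_eulerian lambda_gt0 mu_gt0 mu_neq t0 tr bK.
have [C' eC] := renewal_egf_rate A_eulerian lambda_gt0 mu_gt0 mu_neq D_ge0 t0 tr bK fC f01 fV.
have b_cvg : (eulerian_egf A x N.+2).[- lambda * t] @[N --> \oo] --> - G_fun lambda mu t.
  apply: (@cvg_geometric_rate _ _ _ (C * (t / r) ^+ 2) (t / r)) => // n.
  have [|H _] := bC n.+2 t; first by rewrite t0 lexx.
  by rewrite -mulrA -exprD add2n.
have e_cvg : (renewal_egf A lambda mu D N.+2).[- lambda * t] @[N --> \oo] -->
    (f t - 1) / (D + 1).
  apply: (@cvg_geometric_rate _ _ _ (C' * (t / r) ^+ 2) (t / r)) => // n.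
  by rewrite -mulrA -exprD add2n.
(* The three pieces converge separately, and the limit is then solved for [f t]. *)
have S_cvg : solution_partial_sum d lambda mu A t @ \oo -->
    (f t - 1) / (D + 1) - - G_fun lambda mu t - tail t.
  rewrite -3!cvg_shiftS /=.
  have -> : (fun N => solution_partial_sum d lambda mu A t N.+3) = (fun N =>
      (renewal_egf A lambda mu D N.+2).[- lambda * t]
      - (eulerian_egf A x N.+2).[- lambda * t]
      - \sum_(0 <= n < N.+3) tail_term (- (lambda * t)) n).
    by apply/funext => N; exact: partial_sumE.
  by apply: cvgB; [exact: cvgB | exact: tail_cvg].
split; first exact: cvgP S_cvg.
rewrite /series_solution (cvg_lim _ S_cvg) // -/(G_fun lambda mu t) -/(tail t).
have -> : d%:R = D + 1 :> R by rewrite /D subrK.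
have dn0 : D + 1 != 0 by rewrite /D subrK pnatr_eq0 -lt0n.
by field.
Qed.

End Assembly.

Theorem proposition4p4 (R : realType) (d : nat) (alpha lambda mu : R)
    (disp : measure_display) (T : measurableType disp) (P : probability T R)
    (X : R -> T -> state d) (A : nat -> {poly R})
    (d_gt0 : (0 < d)%N) (lambda_gt0 : 0 < lambda) (mu_gt0 : 0 < mu)
    (alphaE : alpha = lambda) (mu_neq : mu != lambda)
    (X_chain : markov_chain P X origin (star_rate alpha lambda mu))
    (A_eulerian : eulerian_polynomials A) :
  let p := return_probability P X origin in
  [/\ solves_integral_equation d lambda mu p,
      solves_integral_equation d lambda mu (series_solution d lambda mu A) &
      forall t, 0 < t < horizon lambda mu ->
        cvgn (solution_partial_sum d lambda mu A t) /\
        p t = series_solution d lambda mu A t].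
Proof.
move=> p; subst alpha.
have [f [fC f01 f0 pf fV]] :=
  emptiness_volterra d_gt0 lambda_gt0 mu_gt0 mu_neq X_chain.
have fS (t : R) (tH : 0 < t < horizon lambda mu) :=
  volterra_series A_eulerian d_gt0 lambda_gt0 mu_gt0 mu_neq fC f01 fV tH.
(* The integrals run over y = 0 as well, where the convergence result for positive times does not
   apply. *)
have S0 : series_solution d lambda mu A 0 = 1.
  have S_0 N : solution_partial_sum d lambda mu A 0 N = 0.
    rewrite /solution_partial_sum big_nat_cond big1 // => n /andP[/andP[n3 _] _].
    by rewrite /solution_term mulr0 oppr0 expr0n; case: n n3 => //= n _; rewrite !mul0r.
  rewrite /series_solution.
  have -> : solution_partial_sum d lambda mu A 0 = (fun=> 0) by apply/funext.
  rewrite lim_cst // !mulr0 expR0 mulr1.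
  by rewrite divff ?subr_eq0 // !mul0r !(oppr0, expR0, addr0, subrr, mulr0, if_same).
(* The integral up to [t] only sees values on [[0, t]], below the horizon, so agreement with [f]
   there is enough. *)
have equation g : (forall y : R, 0 <= y < horizon lambda mu -> g y = f y) ->
    solves_integral_equation d lambda mu g.
  move=> gf t /andP[t0 tH]; rewrite gf ?tH ?ltW //.
  rewrite (fV t (ltW t0)); congr (_ - _ * _).
  apply: eq_Rintegral => y; rewrite inE /= in_itv /= => /andP[y0 yt].
  rewrite gf ?y0 ?(le_lt_trans yt tH) // derive1_G_fun // subr_ge0 //.
have series_f (y : R) : 0 <= y < horizon lambda mu -> series_solution d lambda mu A y = f y.
  move=> /andP[]; rewrite le_eqVlt => /predU1P[<- _|y0 yH]; first by rewrite S0 f0.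
  by have [|_ ->] := fS y; rewrite ?y0.
split.
- by apply: equation => y /andP[y0 _]; exact: pf.
- exact: equation.
- move=> t tH; have [cvgS fE] := fS t tH; split => //.
  by rewrite -fE; apply: pf; case/andP: tH => /ltW.
Qed.
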